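(* Let $\Phi$ be an aperiodic graphing on a standard probability space $(X,\mu)$. Then $\Phi$ is ergodic if and only if the closure $\overline{D([\Phi]_1)}$ in $[\Phi]_1$ of the derived group of $[\Phi]_1$ is topologically simple.
   Context: A standard probability space $(X,\mu)$ is a standard Borel space with a non-atomic Borel probability measure; everything is up to null sets. $\mathrm{Aut}(X,\mu)$ is the group of measure-preserving Borel bijections of $X$ modulo a.e. equality. A partial isomorphism is a measure-preserving Borel bijection $\varphi:\mathrm{dom}\,\varphi\to\mathrm{rng}\,\varphi$ between Borel subsets of $X$. A graphing $\Phi$ is a countable set of partial isomorphisms; it generates the equivalence relation $\mathcal R_\Phi$, the smallest one containing all $(x,\varphi(x))$ with $\varphi\in\Phi$, $x\in\mathrm{dom}\,\varphi$. $\Phi$ is aperiodic if almost every $\mathcal R_\Phi$-class is infinite, and ergodic if every Borel set that is a union of $\mathcal R_\Phi$-classes (up to null sets) has measure $0$ or $1$. On $\mathcal R_\Phi$-classes put $d_\Phi(x,y)=\min\{n:\exists\varphi_1,\dots,\varphi_n\in\Phi\cup\Phi^{-1},\ y=\varphi_n\cdots\varphi_1(x)\}$. The full group is $[\mathcal R_\Phi]=\{T\in\mathrm{Aut}(X,\mu):(x,T(x))\in\mathcal R_\Phi\text{ a.e.}\}$ and the $\mathrm L^1$ full group is $[\Phi]_1=\{T\in[\mathcal R_\Phi]:\int_Xd_\Phi(x,T(x))\,d\mu<+\infty\}$, with the topology induced by the metric $\tilde d_\Phi(S,T)=\int_Xd_\Phi(S(x),T(x))\,d\mu(x)$. $D(G)$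 denotes the derived subgroup of $G$. A topological group is topologically simple if its only closed normal subgroups are the trivial one and the whole group. *)

(* Defs.v *)
From HB Require Import structures.
From mathcomp Require Import all_boot all_order all_algebra.
From mathcomp Require Import generic_quotient.
From mathcomp Require Import all_classical all_reals all_analysis.
Set Implicit Arguments.
Unset Strict Implicit.
Unset Printing Implicit Defensive.
Import Order.TTheory GRing.Theory Num.Theory.
Local Open Scope classical_set_scope.
Local Open Scope quotient_scope.
Local Open Scope ring_scope.

(* The sigma-algebra of X is the Borel sigma-algebra of a Polish topology,
   transported along the bijection f. *)
Definition standard_borel (R : realType) (d : measure_display)
    (X : measurableType d) : Prop :=
  exists (P : completePseudoMetricType R) (f : X -> P),
    [/\ hausdorff_space P,
        exists2 D : set P, countable D & dense D,
        bijective f &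
        forall A : set X, measurable A <-> (<<s @open P >>) (f @` A)].

Definition nonatomic (R : realType) (d : measure_display)
    (X : measurableType d) (mu : probability X R) : Prop :=
  forall A : set X, measurable A -> (0 < mu A)%E ->
    exists B : set X, [/\ measurable B, B `<=` A, (0 < mu B)%E & (mu B < mu A)%E].

(* The inverse is required to be measurable; on a standard Borel space this is
   automatic by the Lusin-Souslin theorem. *)
Record mpbij (R : realType) (d : measure_display) (X : measurableType d)
    (mu : probability X R) := MPBij {
  mpb_fun :> X -> X;
  mpb_inv : X -> X;
  mpb_funK : cancel mpb_fun mpb_inv;
  mpb_invK : cancel mpb_inv mpb_fun;
  mpb_meas : measurable_fun setT mpb_fun;
  mpb_inv_meas : measurable_fun setT mpb_inv;
  mpb_mu : forall A, measurable A -> mu (mpb_fun @^-1` A) = mu A }.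

HB.instance Definition _ (R : realType) (d : measure_display)
  (X : measurableType d) (mu : probability X R) := gen_eqMixin (mpbij mu).
HB.instance Definition _ (R : realType) (d : measure_display)
  (X : measurableType d) (mu : probability X R) := gen_choiceMixin (mpbij mu).

Section AutGroup.
Context (R : realType) (d : measure_display) (X : measurableType d)
  (mu : probability X R).
Implicit Types f g h : mpbij mu.

Definition mpb_eq f g : bool := `[< {ae mu, forall x, f x = g x} >].

Lemma mpb_eq_refl : reflexive mpb_eq.
Proof. by move=> f; apply/asboolP; apply: aeW. Qed.

Lemma mpb_eq_sym : symmetric mpb_eq.
Proof.
by move=> f g; apply/asboolP/asboolP; apply: filterS => x ->.
Qed.

Lemma mpb_eq_trans : transitive mpb_eq.
Proof.
move=> g f h /asboolP fg /asboolP gh; apply/asboolP.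
by apply: filterS2 fg gh => x -> ->.
Qed.

Canonical mpb_equiv := EquivRel mpb_eq mpb_eq_refl mpb_eq_sym mpb_eq_trans.

Definition Aut := {eq_quot mpb_equiv}.
HB.instance Definition _ := Choice.on Aut.
HB.instance Definition _ := EqQuotient.on Aut.

Lemma aut_eqP f g :
  \pi_Aut f = \pi_Aut g <-> {ae mu, forall x, f x = g x}.
Proof.
split=> [/eqP|fg]; first by rewrite piE => /asboolP.
by apply/eqP; rewrite piE; apply/asboolP.
Qed.

Lemma repr_ae f : {ae mu, forall x, repr (\pi_Aut f) x = f x}.
Proof. by apply/aut_eqP; rewrite reprK. Qed.

Lemma ae_comp f (P : X -> Prop) :
  {ae mu, forall x, P x} -> {ae mu, forall x, P (f x)}.
Proof.
move=> [N [mN N0 PN]]; exists (f @^-1` N); split.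
- by rewrite -[_ @^-1` _]setTI; apply: mpb_meas.
- by rewrite mpb_mu.
- by move=> x Px; apply: PN.
Qed.

Program Definition mpb_one : mpbij mu := @MPBij _ _ _ mu id id _ _ _ _ _.
Next Obligation. by []. Qed.
Next Obligation. by []. Qed.
Next Obligation. exact: measurable_id. Qed.
Next Obligation. exact: measurable_id. Qed.
Next Obligation. by []. Qed.

Program Definition mpb_mul f g : mpbij mu :=
  @MPBij _ _ _ mu (f \o g) (mpb_inv g \o mpb_inv f) _ _ _ _ _.
Next Obligation. by move=> f g; apply: can_comp; apply: mpb_funK. Qed.
Next Obligation. by move=> f g; apply: can_comp; apply: mpb_invK. Qed.
Next Obligation. by move=> f g; apply: measurableT_comp; apply: mpb_meas. Qed.
Next Obligation. by move=> f g; apply: measurableT_comp; apply: mpb_inv_meas. Qed.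
Next Obligation.
move=> f g A mA; rewrite comp_preimage !mpb_mu//.
by rewrite -[_ @^-1` _]setTI; apply: mpb_meas.
Qed.

Program Definition mpb_V f : mpbij mu := @MPBij _ _ _ mu (mpb_inv f) f _ _ _ _ _.
Next Obligation. by move=> f; apply: mpb_invK. Qed.
Next Obligation. by move=> f; apply: mpb_funK. Qed.
Next Obligation. by move=> f; apply: mpb_inv_meas. Qed.
Next Obligation. by move=> f; apply: mpb_meas. Qed.
Next Obligation.
move=> f A mA; have mB : measurable (mpb_inv f @^-1` A).
  by rewrite -[_ @^-1` _]setTI; apply: mpb_inv_meas.
rewrite -(mpb_mu f mB); congr (mu _).
by apply/seteqP; split=> x /=; rewrite mpb_funK.
Qed.

Definition aut_one : Aut := \pi_Aut mpb_one.
Definition aut_mul (S T : Aut) : Aut := \pi_Aut (mpb_mul (repr S) (repr T)).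
Definition aut_inv (T : Aut) : Aut := \pi_Aut (mpb_V (repr T)).

Lemma aut_mulE f g :
  aut_mul (\pi_Aut f) (\pi_Aut g) = \pi_Aut (mpb_mul f g).
Proof.
apply/aut_eqP; apply: filterS2 (repr_ae g) (ae_comp (repr (\pi_Aut g)) (repr_ae f)) => x /=.
by move=> -> ->.
Qed.

Lemma aut_invE f : aut_inv (\pi_Aut f) = \pi_Aut (mpb_V f).
Proof.
apply/aut_eqP; have := ae_comp (mpb_V f) (repr_ae f); apply: filterS => x /=.
by rewrite mpb_invK => e; rewrite -[in LHS]e mpb_funK.
Qed.

Lemma aut_mulA : associative aut_mul.
Proof.
move=> S T U; rewrite -[S]reprK -[T]reprK -[U]reprK !aut_mulE !reprK.
by apply/aut_eqP; apply: aeW.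
Qed.

Lemma aut_mul1 : left_id aut_one aut_mul.
Proof.
by move=> T; rewrite -[T]reprK aut_mulE; apply/aut_eqP; apply: aeW.
Qed.

Lemma aut_mulr1 : right_id aut_one aut_mul.
Proof.
by move=> T; rewrite -[T]reprK aut_mulE; apply/aut_eqP; apply: aeW.
Qed.

Lemma aut_mulV : left_inverse aut_one aut_inv aut_mul.
Proof.
move=> T; rewrite -[T]reprK aut_invE aut_mulE; apply/aut_eqP; apply: aeW => x /=.
exact: mpb_funK.
Qed.

Lemma aut_mulrV : right_inverse aut_one aut_inv aut_mul.
Proof.
move=> T; rewrite -[T]reprK aut_invE aut_mulE; apply/aut_eqP; apply: aeW => x /=.
exact: mpb_invK.
Qed.

HB.instance Definition _ :=
  isGroup.Build Aut aut_mulA aut_mul1 aut_mulr1 aut_mulV aut_mulrV.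

End AutGroup.

(* A representative of the class T; every use below depends on it only up to
   null sets. *)
Definition aut_fun (R : realType) (d : measure_display) (X : measurableType d)
  (mu : probability X R) (T : Aut mu) : X -> X := repr T.
Coercion aut_fun : Aut >-> Funclass.

(* The values of pi_fun outside pi_dom and of pi_inv outside pi_rng are junk. *)
Record partial_iso (R : realType) (d : measure_display) (X : measurableType d)
    (mu : probability X R) := PartialIso {
  pi_dom : set X;
  pi_rng : set X;
  pi_fun :> X -> X;
  pi_inv : X -> X;
  pi_mdom : measurable pi_dom;
  pi_mrng : measurable pi_rng;
  pi_mfun : measurable_fun pi_dom pi_fun;
  pi_minv : measurable_fun pi_rng pi_inv;
  pi_funS : set_fun pi_dom pi_rng pi_fun;
  pi_invS : set_fun pi_rng pi_dom pi_inv;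
  pi_funK : {in pi_dom, cancel pi_fun pi_inv};
  pi_invK : {in pi_rng, cancel pi_inv pi_fun};
  pi_mu : forall B, measurable B -> B `<=` pi_rng ->
    mu (pi_dom `&` pi_fun @^-1` B) = mu B }.

Section Graphing.
Context (R : realType) (d : measure_display) (X : measurableType d)
  (mu : probability X R).
Implicit Types (Phi : set (partial_iso mu)) (S T : Aut mu).

Lemma pi_V_mu (phi : partial_iso mu) (B : set X) :
  measurable B -> B `<=` pi_dom phi ->
  mu (pi_rng phi `&` pi_inv phi @^-1` B) = mu B.
Proof.
move=> mB BD.
have mC : measurable (pi_rng phi `&` pi_inv phi @^-1` B).
  by apply: pi_minv => //; apply: pi_mrng.
rewrite -(pi_mu mC (@subIsetl _ _ _)); congr (mu _).
apply/seteqP; split => x /= => [[Dx [_]]|Bx].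
  by rewrite pi_funK// inE.
have Dx := BD _ Bx; split => //; split; first exact: pi_funS.
by rewrite pi_funK// inE.
Qed.

Definition pi_V (phi : partial_iso mu) : partial_iso mu :=
  @PartialIso _ _ _ mu (pi_rng phi) (pi_dom phi) (pi_inv phi) phi
    (@pi_mrng _ _ _ _ phi) (@pi_mdom _ _ _ _ phi)
    (@pi_minv _ _ _ _ phi) (@pi_mfun _ _ _ _ phi)
    (@pi_invS _ _ _ _ phi) (@pi_funS _ _ _ _ phi)
    (@pi_invK _ _ _ _ phi) (@pi_funK _ _ _ _ phi)
    (@pi_V_mu phi).

Definition graphing Phi : Prop := countable Phi.

Definition equivalence_relation (E : set (X * X)) : Prop :=
  [/\ forall x, E (x, x),
      forall x y, E (x, y) -> E (y, x) &
      forall x y z, E (x, y) -> E (y, z) -> E (x, z)].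

Definition orbit_rel Phi : set (X * X) :=
  smallest equivalence_relation
    [set p | exists2 phi, Phi phi & pi_dom phi p.1 /\ p.2 = phi p.1].

Definition aperiodic Phi : Prop :=
  {ae mu, forall x, infinite_set [set y | orbit_rel Phi (x, y)]}.

Definition saturated Phi (B : set X) : Prop :=
  forall x y, orbit_rel Phi (x, y) -> B x -> B y.

Definition ergodic Phi : Prop :=
  forall A : set X, measurable A ->
    (exists2 B : set X, saturated Phi B & mu.-negligible (A `+` B)) ->
    mu A = 0%E \/ mu A = 1%E.

Definition symmetrized Phi : set (partial_iso mu) := Phi `|` pi_V @` Phi.

(* walk Phi n x y: y is the image of x under a composition of n elements of
   the symmetrized graphing, each applied inside its domain. *)
Fixpoint walk Phi (n : nat) (x y : X) : Prop :=
  if n is m.+1 then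
    exists2 phi, symmetrized Phi phi & pi_dom phi x /\ walk Phi m (phi x) y
  else y = x.

(* The distance is +oo between points in different orbits. *)
Definition graph_dist Phi (x y : X) : \bar R :=
  ereal_inf [set n%:R%:E | n in [set n | walk Phi n x y]].

Lemma walk_cat Phi m n x y z :
  walk Phi m x y -> walk Phi n y z -> walk Phi (m + n) x z.
Proof.
elim: m x => [x /= -> //|m IH x /= [phi sphi [Dx w]] w'].
by exists phi => //; split => //; apply: IH.
Qed.

Lemma symmetrizedV Phi phi x : symmetrized Phi phi -> pi_dom phi x ->
  exists2 psi, symmetrized Phi psi & pi_dom psi (phi x) /\ psi (phi x) = x.
Proof.
move=> [Pphi|[psi Ppsi <-]] Dx.
  exists (pi_V phi); first by right; exists phi.
  by split; [apply: pi_funS | rewrite /= pi_funK// inE].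
exists psi; first by left.
by split; [apply: pi_invS | rewrite /= pi_invK// inE].
Qed.

Lemma walk_sym Phi n x y : walk Phi n x y -> walk Phi n y x.
Proof.
elim: n x => [x /= -> //|n IH x /= [phi sphi [Dx w]]].
have [psi spsi [Dy e]] := symmetrizedV sphi Dx.
have w1 : walk Phi 1 (phi x) x by exists psi.
by have := walk_cat (IH _ w) w1; rewrite addn1.
Qed.

Lemma orbit_relE Phi x y : orbit_rel Phi (x, y) <-> exists n, walk Phi n x y.
Proof.
split=> [|[n]].
  move=> /(_ [set p | exists n, walk Phi n p.1 p.2]); apply; split.
    split=> [z|u v [n w]|u v z [n w] [m w']]; first by exists 0%N.
      by exists n; apply: walk_sym.
    by exists (n + m)%N; apply: walk_cat w w'.
  move=> [u v] [phi Pphi /= [Dx ->]]; exists 1%N, phi => //; by left.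
elim: n x => [x /= -> E [[E1 _ _] _]|n IH x /= [phi sphi [Dx w]] E [eqE sE]].
  exact: E1.
have [_ E2 E3] := eqE.
apply: (E3 _ (phi x)); last exact: IH w _ _.
case: sphi Dx => [Pphi|[psi Ppsi <-]] Dx.
  by apply: sE; exists phi.
apply: E2; apply: sE; exists psi => //=; split; first exact: pi_invS.
by rewrite pi_invK// inE.
Qed.

Lemma graph_dist_lty Phi x y :
  (graph_dist Phi x y < +oo)%E <-> orbit_rel Phi (x, y).
Proof.
rewrite orbit_relE; split=> [/ereal_inf_lt[_ [n wn _] _]|[n wn]]; first by exists n.
by apply: (@le_lt_trans _ _ n%:R%:E); rewrite ?ltry//; apply: ereal_inf_lbound; exists n.
Qed.

Definition full_group Phi : set (Aut mu) :=
  [set T | {ae mu, forall x, orbit_rel Phi (x, T x)}].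

Definition L1_full_group Phi : set (Aut mu) :=
  [set T | full_group Phi T /\ (\int[mu]_x graph_dist Phi x (T x) < +oo)%E].

Definition L1_dist Phi S T : \bar R :=
  (\int[mu]_x graph_dist Phi (S x) (T x))%E.

End Graphing.

Definition derived_subgroup (gT : groupType) (G : set gT) : set gT :=
  smallest (fun H : set gT => group_closed (mem H))
    [set [~ x, y]%g | x in G & y in G].

(* The closure of A in G for the topology that the metric rho induces on G. *)
Definition closure_in (R : realType) (T : Type) (rho : T -> T -> \bar R)
    (G A : set T) : set T :=
  [set x | G x /\ forall e : R, 0 < e -> exists2 y, A y & (rho x y < e%:E)%E].

Definition topologically_simple (R : realType) (gT : groupType)
    (rho : gT -> gT -> \bar R) (G : set gT) : Prop :=
  forall N : set gT, N `<=` G -> group_closed (mem N) ->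
    (forall g x, G g -> N x -> N (x ^ g)%g) ->
    closure_in rho G N = N ->
    N = [set 1%g] \/ N = G.

(* Main.v *)
Require Import Defs.
From mathcomp Require Import all_boot all_order all_algebra.
From mathcomp Require Import generic_quotient lra.
From mathcomp Require Import all_classical all_reals all_analysis.
From mathcomp Require Import measurable_realfun.
Import Defs.

(** Write [G] for the L1 full group, [rho] for its metric, [D] for its derived
    subgroup, and call exchange the involution [swap T C] that exchanges a set [C]
    with its image under [T], when these are disjoint.

    The metric is invariant under right translations, and left translation by a
    fixed element is continuous, because an integrable displacement has small
    integral over small sets ([rho_mull]). Hence closures of subgroups are
    subgroups. The orbit relation is covered by the graphs of countably many
    elements of [G] ([orbit_maps]), so that countable partitions reduce local
    constructions to permutations of finitely many disjoint pieces [e i @` E] with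
    [e i] in [G] ([permute_pieces]).

    If the closure of [D] is topologically simple and [A] is an invariant set that
    is neither null nor conull, the elements supported on [A] form a closed normal
    subgroup. It is nontrivial and proper, since on any invariant set of positive
    measure aperiodicity gives three disjoint pieces, and thereby two transpositions
    that do not commute ([simple_ergodic]).

    Conversely let [N] be a nontrivial closed normal subgroup of the closure of [D].
    Some element of [N] moves a set [A0] of positive measure off itself. By a double
    commutator trick, [N] contains the commutators of the elements of [D] supported
    in [A0] ([N_commg]), among them an even permutation of pieces in [A0]. Ergodicity
    provides pieces of [A0] matching any small piece of the space, and conjugating by
    an even permutation moves the permutation there ([paired_swap_normal]). An
    exchange becomes an even permutation once [C] is cut, up to a null set, into
    pairs of pieces matched by orbit maps, which is possible by ergodicity and
    non-atomicity ([off_swap]). Thus all exchanges are in [N] ([swap_normal]).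

    Finally the commutators of [G] lie in every closed normal subgroup [H] of [G]
    that contains the exchanges ([commg_in_swaps]). Let [S] and [T] be in [G], and let
    [B] be a set that [S] moves off itself and that meets every nontrivial orbit of
    [T]. Modulo [H], replace [S] by [swap S B * S], which is the identity on [B].
    Composing [T] with exchanges of the levels of its towers over [B] replaces [T] by
    approximations of its first return map, supported on [B] ([flatten_levels]).
    The new elements almost commute ([almost_commuting]). In general, [T] is cut along
    countably many invariant sets on each of which such a set [B] exists. *)

Set Implicit Arguments.
Unset Strict Implicit.
Unset Printing Implicit Defensive.
Import Order.TTheory GRing.Theory Num.Theory.
Local Open Scope classical_set_scope.
Local Open Scope ring_scope.

(** * A countable separating family *)

(** Preimages of small balls around the points of a countable dense set separate
    points, the Polish topology being Hausdorff. *)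
Lemma separating_family (R : realType) (d : measure_display)
    (X : measurableType d) : standard_borel R X ->
  exists B : nat -> set X, (forall i, measurable (B i)) /\
    forall x y, x <> y -> exists i, B i x /\ ~ B i y.
Proof.
move=> [P [f [hP [D /countable_injP[g ginj] dD] bijf mE]]].
have [h fK hK] := bijf.
(* A union over the at most one centre with code [nk.1], which avoids choosing
   a default centre for the unused codes. *)
pose U (nk : nat * nat) : set P :=
  \bigcup_(p in [set p | D p /\ g p = nk.1]) interior (ball p (nk.2.+1%:R^-1 : R)).
exists (fun i => if unpickle i is Some nk then f @^-1` (U nk) else set0).
split=> [i|x y xy].
  case: (unpickle i) => // nk; apply/mE.
  have -> : f @` (f @^-1` U nk) = U nk.
    apply/seteqP; split=> [_ [z zU <-]//|z Uz]; by exists (h z); rewrite /= hK.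
  by apply: sub_sigma_algebra; apply: bigcup_open => p _; apply: open_interior.
move: hP; rewrite open_hausdorff => /(_ (f x) (f y)).
have fxy : f x != f y by apply/eqP => /(bij_inj bijf).
move=> /(_ fxy) [[V W] /= [xV yW] [oV oW /eqP VW]].
have /nbhs_ballP[e /= e0 eV] : nbhs (f x) V.
  by apply: open_nbhs_nbhs; split => //; rewrite inE in xV.
have [k ke] : exists k : nat, k.+1%:R^-1 < e / 2.
  have e20 : 0 < e / 2 by rewrite divr_gt0.
  exists (Num.truncn (e / 2)^-1).
  rewrite invf_plt ?posrE//; exact: truncnS_gt.
pose r : R := k.+1%:R^-1.
have r0 : 0 < r by rewrite invr_gt0.
have [p [Bp Dp]] : (interior (ball (f x) (r / 2)) `&` D) !=set0.
  apply: dD; last exact: open_interior.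
  by exists (f x); apply: nbhsx_ballx; rewrite divr_gt0.
have {}Bp : ball (f x) (r / 2) p by apply: interior_subset.
exists (pickle (g p, k)); rewrite pickleK; split.
  exists p => //=; apply/nbhs_ballP; exists (r / 2); first by rewrite /= divr_gt0.
  move=> z Bz; apply: (@ball_split _ _ (f x)) => //; exact: ball_sym.
move=> [q [/= Dq gq]].
have -> : q = p by apply: ginj; rewrite ?inE.
move=> /interior_subset pfy; have : V (f y).
  apply: eV; apply: (@ball_split _ _ p).
    apply: (@le_ball _ _ _ (r / 2)) => //; have := ltW ke; rewrite -/r; lra.
  by apply: le_ball pfy; exact: ltW.
move=> Vy; have : (V `&` W) (f y) by split => //; rewrite inE in yW.
by rewrite VW.
Qed.

(** * Measurability of sets given by first-order formulas *)

Section FormulaMeasurability.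
Context (d : measure_display) (X : measurableType d).
Implicit Types P Q : X -> Prop.

Lemma mset_and P Q : measurable [set x | P x] -> measurable [set x | Q x] ->
  measurable [set x | P x /\ Q x].
Proof. by move=> mP mQ; apply: (measurableI _ _ mP mQ). Qed.

Lemma mset_or P Q : measurable [set x | P x] -> measurable [set x | Q x] ->
  measurable [set x | P x \/ Q x].
Proof. by move=> mP mQ; apply: (measurableU _ _ mP mQ). Qed.

Lemma mset_not P : measurable [set x | P x] -> measurable [set x | ~ P x].
Proof. by move=> mP; apply: (measurableC mP). Qed.

Lemma mset_const (p : Prop) : measurable [set x : X | p].
Proof.
have [hp|hp] := pselect p.
  by have -> : [set _ : X | p] = setT by apply/seteqP; split.
by have -> : [set _ : X | p] = set0 by apply/seteqP; split.
Qed.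

Lemma mset_imp P Q : measurable [set x | P x] -> measurable [set x | Q x] ->
  measurable [set x | P x -> Q x].
Proof.
move=> mP mQ; have := mset_or (mset_not mP) mQ; congr measurable.
apply/seteqP; split => x /= => [[]//|]; have [Px /(_ Px)|] := pselect (P x); tauto.
Qed.

Lemma mset_ex (K : countType) (P : K -> X -> Prop) :
  (forall k, measurable [set x | P k x]) -> measurable [set x | exists k, P k x].
Proof.
move=> mP.
have := @countable_bigcupT_measurable _ X K (fun k => [set x | P k x])
  (countableP _) mP.
congr measurable.
by apply/seteqP; split=> x /= => [[k _]|[k]] Pk; exists k.
Qed.

Lemma mset_all (K : countType) (P : K -> X -> Prop) :
  (forall k, measurable [set x | P k x]) -> measurable [set x | forall k, P k x].
Proof.
move=> mP; have := mset_not (mset_ex (fun k => mset_not (mP k))).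
congr measurable; apply/seteqP; split => x /= H.
  by move=> k; apply: contrapT => nP; apply: H; exists k.
by case=> k; apply; exact: H.
Qed.

End FormulaMeasurability.

Section Glue.
Context (R : realType) (d : measure_display) (X : measurableType d)
  (mu : probability X R).
Implicit Types f g h : mpbij mu.

Lemma mset_mpb f (P : X -> Prop) :
  measurable [set x | P x] -> measurable [set x | P (f x)].
Proof. by move=> mP; rewrite -[X in measurable X]setTI; apply: (mpb_meas f). Qed.

Lemma mset_mpbV f (P : X -> Prop) :
  measurable [set x | P x] -> measurable [set x | P (mpb_inv f x)].
Proof. by move=> mP; rewrite -[X in measurable X]setTI; apply: (mpb_inv_meas f). Qed.

Lemma mu_mpb f (P : X -> Prop) : measurable [set x | P x] ->
  mu [set x | P (f x)] = mu [set x | P x].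
Proof. by move=> mP; rewrite -(mpb_mu f mP). Qed.

Lemma mu_mpbV f (P : X -> Prop) : measurable [set x | P x] ->
  mu [set x | P (mpb_inv f x)] = mu [set x | P x].
Proof. exact: (mu_mpb (mpb_V f)). Qed.

Section glue.
Variables (K : countType) (f g : X -> X) (h : K -> mpbij mu) (A : K -> set X).
Hypotheses (fK : cancel f g) (gK : cancel g f) (mA : forall k, measurable (A k))
  (cA : forall x, exists k, A k x) (fA : forall k x, A k x -> f x = h k x).

Lemma glue_measurable : measurable_fun setT f.
Proof.
move=> _ B mB; rewrite setTI.
have : measurable [set x | exists k, A k x /\ B (h k x)].
  by apply: mset_ex => k; apply: mset_and; [exact: mA|exact: mset_mpb].
congr measurable; apply/seteqP; split => x /=.
  by move=> [k [/fA <-]].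
by have [k Ak] := cA x => Bx; exists k; rewrite -(fA Ak).
Qed.

Lemma glue_inv_measurable : measurable_fun setT g.
Proof.
move=> _ B mB; rewrite setTI.
have : measurable [set y | exists k, A k (mpb_inv (h k) y) /\ B (mpb_inv (h k) y)].
  apply: mset_ex => k.
  by apply: mset_and; apply: mset_mpbV => //; exact: mA.
congr measurable; apply/seteqP; split => y /=.
  by move=> [k [/fA]]; rewrite mpb_invK => e Bx; rewrite -e fK.
have [k Ak] := cA (g y) => By; exists k.
have := fA Ak; rewrite gK => E; have -> : mpb_inv (h k) y = g y by rewrite {1}E mpb_funK.
by [].
Qed.

(** Disjointify the cover. On each part the preimage of [B] is carried by a single
    [h k] onto the trace of [B] on the image of that part, and these images
    partition the space because [f] is a bijection. *)
Lemma glue_mu B : measurable B -> mu (f @^-1` B) = mu B.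
Proof.
move=> mB.
pose F := seqDU (fun n => if unpickle n is Some k then A k else set0).
have mF n : measurable (F n).
  by apply: seqDU_measurable => {}n; case: (unpickle n).
have tF : trivIset setT F by exact: trivIset_seqDU.
have cF x : exists n, F n x.
  have [k Ak] := cA x.
  have : (\bigcup_n F n) x.
    by rewrite -seqDU_bigcup_eq; exists (pickle k) => //; rewrite pickleK.
  by move=> [n _ Fn]; exists n.
have mg (C : set X) : measurable C -> measurable (g @^-1` C).
  by move=> mC; rewrite -[_ @^-1` _]setTI; apply: glue_inv_measurable.
have mf (C : set X) : measurable C -> measurable (f @^-1` C).
  by move=> mC; rewrite -[_ @^-1` _]setTI; apply: glue_measurable.
have -> : f @^-1` B = \bigcup_n (F n `&` f @^-1` B).
  apply/seteqP; split => x /= => [Bx|[n _ []]//].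
  by have [n Fn] := cF x; exists n.
have -> : mu B = mu (\bigcup_n (g @^-1` (F n) `&` B)).
  congr (mu _); apply/seteqP; split => x /= => [Bx|[n _ []]//].
  by have [n Fn] := cF (g x); exists n.
rewrite !measure_bigcup//; last 4 first.
- by move=> n _; apply: measurableI => //; exact: mg.
- move=> i j _ _ [x [[/= Fi _] [Fj _]]].
  by apply: (tF i j) => //; exists (g x).
- by move=> n _; apply: measurableI => //; exact: mf.
- move=> i j _ _ [x [[/= Fi _] [Fj _]]].
  by apply: (tF i j) => //; exists x.
apply: eq_eseriesr => n _.
have Fh : (exists k, forall x, F n x -> f x = h k x) \/ F n = set0.
  have FS : F n `<=` (if unpickle n is Some k then A k else set0) by move=> x [].
  move: FS; case: (unpickle n) => [k FS|FS]; [left|right].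
    by exists k => x /FS; exact: fA.
  by apply/seteqP; split.
case: Fh => [[k Fh]|->]; last by rewrite preimage_set0 !set0I.
apply: etrans (mpb_mu (h k) _); last by apply: measurableI => //; exact: mg.
congr (mu _); apply/seteqP; split => x /=.
  by move=> [Fx Bx]; rewrite -(Fh _ Fx) fK.
move=> [Fx Bx]; have E := Fh _ Fx; rewrite gK in E.
have E' : g (h k x) = x by rewrite -[LHS](mpb_funK (h k)) -E mpb_funK.
by move: Fx Bx; rewrite E' => Fx Bx; split=> //; rewrite (Fh _ Fx).
Qed.

Definition glue : mpbij mu :=
  MPBij fK gK glue_measurable glue_inv_measurable glue_mu.

End glue.
End Glue.

(** * The graph distance *)

(** A countable family of measurable sets separating the points is the only trace
    of the standard Borel structure in the proof: it makes coincidence sets of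
    measurable maps measurable, and it cuts a map without fixed points into pieces
    that are disjoint from their images. *)
Class separated_graphing (R : realType) (d : measure_display)
    (X : measurableType d) (mu : probability X R)
    (Phi : set (partial_iso mu)) := SeparatedGraphing {
  sep : nat -> set X;
  msep : forall i, measurable (sep i);
  sepP : forall x y, x <> y -> exists i, sep i x /\ ~ sep i y;
  cPhi : countable Phi }.
Arguments sep {R d X mu} Phi {separated_graphing} i : rename.
Arguments sepP {R d X mu} Phi {separated_graphing} [x y] : rename.

Section GraphDist.
Context (R : realType) (d : measure_display) (X : measurableType d)
  (mu : probability X R) (Phi : set (partial_iso mu)).
Local Notation dist := (graph_dist Phi).
Local Open Scope ereal_scope.

Lemma dist_walk n x y : walk Phi n x y -> dist x y <= n%:R%:E.
Proof. by move=> w; apply: ereal_inf_lbound; exists n. Qed.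

Lemma dist_ge0 x y : 0 <= dist x y.
Proof. by apply: le_ereal_inf_tmp => _ [n _ <-]; rewrite lee_fin. Qed.

Lemma dist_attained x y : orbit_rel Phi (x, y) ->
  exists2 n, walk Phi n x y & dist x y = n%:R%:E.
Proof.
rewrite orbit_relE => -[n wn].
have ex : exists n, `[< walk Phi n x y >] by exists n; apply/asboolP.
case: (ex_minnP ex) => m /asboolP wm mmin; exists m => //.
apply/eqP; rewrite eq_le dist_walk//=.
apply: le_ereal_inf_tmp => _ [k wk <-]; rewrite lee_fin ler_nat.
by apply: mmin; apply/asboolP.
Qed.

Lemma dist_infty x y : ~ orbit_rel Phi (x, y) -> dist x y = +oo.
Proof.
move=> nr; apply/eqP; rewrite -leye_eq; apply: le_ereal_inf_tmp => _ [n wn <-].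
by exfalso; apply: nr; rewrite orbit_relE; exists n.
Qed.

Lemma distxx x : dist x x = 0.
Proof. by apply/eqP; rewrite eq_le dist_ge0 (@dist_walk 0). Qed.

Lemma dist_sym x y : dist x y = dist y x.
Proof.
rewrite /graph_dist; congr (ereal_inf _); apply/seteqP.
by split => r [n /= wn <-]; exists n => //; exact: walk_sym.
Qed.

Lemma dist_tri y x z : dist x z <= dist x y + dist y z.
Proof.
have [/dist_attained[n wn ->]|/dist_infty->] := pselect (orbit_rel Phi (x, y)); last first.
  by rewrite addye ?leey// -ltNye (lt_le_trans _ (dist_ge0 _ _)).
have [/dist_attained[m wm ->]|/dist_infty->] := pselect (orbit_rel Phi (y, z)).
  by rewrite -EFinD -natrD; apply: dist_walk; exact: walk_cat wn wm.
by rewrite addey ?leey.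
Qed.

Lemma dist_ge1 x y : x <> y -> 1 <= dist x y.
Proof.
move=> xy; apply: le_ereal_inf_tmp => _ [[|n] wn <-].
  by case: xy; rewrite wn.
by rewrite lee_fin ler1n.
Qed.

Section measurability.
Context {SG : separated_graphing Phi}.

Lemma sep_eq (x y : X) : x = y <-> forall i, sep Phi i x -> sep Phi i y.
Proof.
split=> [->//|H]; apply: contrapT => /(sepP Phi)[i [xi]]; apply; exact: H.
Qed.

Lemma measurable_eq_on (E : set X) (f g : X -> X) : measurable E ->
  measurable_fun E f -> measurable_fun E g ->
  measurable [set x | E x /\ f x = g x].
Proof.
move=> mE mf mg.
have : measurable [set x | E x /\
    forall i, (E x /\ sep Phi i (f x)) -> (E x /\ sep Phi i (g x))].
  apply: mset_and => //; apply: mset_all => i; apply: mset_imp.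
    by apply: mf => //; exact: msep.
  by apply: mg => //; exact: msep.
congr measurable; apply/seteqP; split => x /= [Ex].
  by move=> H; split => //; apply/sep_eq => i fi; have [] := H i (conj Ex fi).
by move=> ->.
Qed.

Lemma countable_symmetrized : countable (symmetrized Phi).
Proof.
rewrite /symmetrized; have -> : Phi `|` (@pi_V R d X mu) @` Phi =
  \bigcup_(b in [set: bool]) (if b then Phi else (@pi_V R d X mu) @` Phi).
  apply/seteqP; split => x.
    by move=> [?|?]; [exists true|exists false].
  by move=> [[] _ ?]; [left|right].
apply: bigcup_countable => // -[] _ //.
exact: cPhi.
exact: (card_le_trans (card_image_le _ _) cPhi).
Qed.

(** A walk starts with one of countably many steps, so the set is a countable union
    of sets given by walks that are one step shorter. *)
Lemma measurable_walk n (E : set X) (f g : X -> X) : measurable E ->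
  measurable_fun E f -> measurable_fun E g ->
  measurable [set x | E x /\ walk Phi n (f x) (g x)].
Proof.
elim: n E f => [|n IH] E f mE mf mg /=.
  exact: measurable_eq_on.
have /countable_injP[c cinj] := countable_symmetrized.
have : measurable [set x | exists k : nat, exists2 phi,
    symmetrized Phi phi /\ c phi = k &
    (E x /\ pi_dom phi (f x)) /\ walk Phi n (phi (f x)) (g x)].
  apply: mset_ex => k.
  have [[phi [Sphi cphi]]|nphi] :=
    pselect (exists phi, symmetrized Phi phi /\ c phi = k); last first.
    have := mset_const X False; congr measurable.
    by apply/seteqP; split => x //= [phi ? _]; apply: nphi; exists phi.
  have mE' : measurable [set x | E x /\ pi_dom phi (f x)].
    by apply: mf => //; exact: pi_mdom.
  have mphif : measurable_fun [set x | E x /\ pi_dom phi (f x)] (phi \o f).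
    apply: (@measurable_comp _ _ _ _ _ _ (pi_dom phi)).
    - exact: pi_mdom.
    - by move=> _ [x [_ ?] <-].
    - exact: pi_mfun.
    - by apply: measurable_funS mf => // x [].
  have mg' : measurable_fun [set x | E x /\ pi_dom phi (f x)] g.
    by apply: measurable_funS mg => // x [].
  have := IH _ _ mE' mphif mg'.
  congr measurable; apply/seteqP; split => x /=; first by exists phi.
  move=> [psi [Spsi cpsi]].
  have -> : psi = phi by apply: cinj; rewrite ?inE// cpsi.
  by [].
congr measurable; apply/seteqP; split => x /=.
  by move=> [k [phi [Sphi _] [[Ex Dx] w]]]; split => //; exists phi.
by move=> [Ex [phi Sphi [Dx w]]]; exists (c phi), phi.
Qed.

Lemma measurable_dist (f g : X -> X) :
  measurable_fun setT f -> measurable_fun setT g ->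
  measurable_fun setT (fun x => dist (f x) (g x)).
Proof.
move=> mf mg.
pose u n x : \bar R := if `[< walk Phi n (f x) (g x) >] then n%:R%:E else +oo.
have -> : (fun x => dist (f x) (g x)) = (fun x => einfs (u^~ x) 0%N).
  apply/funext => x; rewrite /einfs /sdrop; apply/eqP; rewrite eq_le; apply/andP; split.
    apply: le_ereal_inf_tmp => _ [n _ <-]; rewrite /u.
    by case: asboolP => [|_]; [exact: dist_walk|exact: leey].
  apply: le_ereal_inf_tmp => _ [n wn <-]; apply: ereal_inf_lbound; exists n => //.
  by rewrite /u asboolT.
apply: measurable_fun_einfs => n; apply: measurable_fun_ifT => //.
apply: (measurable_fun_bool true); rewrite setTI.
have := measurable_walk n measurableT mf mg; congr measurable.
by apply/seteqP; split => x /= => [[_ w]|/asboolP w//]; exact/asboolP.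
Qed.

End measurability.
End GraphDist.

(** * Absolute continuity of the integral *)

Section AbsoluteContinuity.
Context (R : realType) (d : measure_display) (X : measurableType d)
  (mu : probability X R).
Local Open Scope ereal_scope.

Lemma mu_vanishing (F : nat -> set X) : (forall n, measurable (F n)) ->
  (forall n x, F n.+1 x -> F n x) -> mu (\bigcap_n F n) = 0 ->
  forall e : R, (0 < e)%R -> exists n, mu (F n) < e%:E.
Proof.
move=> mF dF F0 e e0.
have /= cv : (mu \o F) x @[x --> \oo] --> mu (\bigcap_n F n).
  apply: nonincreasing_cvg_mu => //.
  - by rewrite (le_lt_trans (probability_le1 mu _)) ?ltry.
  - by apply: bigcapT_measurable.
  - move=> n m; move=> /subnK <-; rewrite subsetEset.
    by elim: (m - n)%N => [|k IH] // x /= /dF; exact: IH.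
have : nbhs (mu (\bigcap_n F n)) [set y | y < e%:E].
  apply: open_nbhs_nbhs; split; first exact: open_ereal_lt_ereal.
  by rewrite /= F0 lte_fin.
by move=> /cv [n _ /(_ n (leqnn n))]; exists n.
Qed.

(** Off a set of small integral, [f] is bounded by some [n], and there the
    integral over a set is at most [n] times its measure. *)
Lemma integral_small (f : X -> \bar R) : measurable_fun setT f ->
  (forall x, 0 <= f x) -> \int[mu]_x f x < +oo ->
  forall e : R, (0 < e)%R -> exists2 dl : R, (0 < dl)%R &
    forall A, measurable A -> mu A < dl%:E -> \int[mu]_(x in A) f x < e%:E.
Proof.
move=> mf f0 ffin e e0.
pose F n := [set x | f x <= n%:R%:E].
have mF n : measurable (F n).
  by have := emeasurable_fun_infty_c measurableT mf n%:R%:E; rewrite setTI.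
have mfA A : measurable_fun A f by apply: measurable_funS mf.
have hF : {homo F : n m / (n <= m)%N >-> (n <= m)%O}.
  move=> n m nm; rewrite subsetEset => x /= /le_trans; apply.
  by rewrite lee_fin ler_nat.
have cv := @ge0_nondecreasing_set_cvg_integral _ _ _ F f mu hF mF (fun i => mfA _)
  (fun _ x _ => f0 x).
have intf : mu.-integrable setT f.
  by apply/integrableP; split => //; under eq_integral do rewrite gee0_abs//.
have U0 : \int[mu]_(x in ~` \bigcup_n F n) f x = 0.
  have aef := integrable_ae measurableT intf.
  rewrite (ge0_ae_eq_integral (g := cst 0)) ?integral0//.
  - by apply: measurableC; exact: bigcupT_measurable.

  apply: filterS aef => x /(_ I) fx; case; exists (Num.truncn (fine (f x))).+1 => //.
  rewrite /F /=; move: fx; case: (f x) => [r| |]//= _; rewrite lee_fin ltW//.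
  exact: truncnS_gt.
pose I := \int[mu]_(x in \bigcup_n F n) f x.
have mU : measurable (\bigcup_n F n) by exact: bigcupT_measurable.
have Ifin : I \is a fin_num.
  rewrite ge0_fin_numE ?integral_ge0//; apply: le_lt_trans ffin.
  by apply: ge0_subset_integral.
have [n In] : exists n, I - (e / 2)%:E < \int[mu]_(x in F n) f x.
  have : nbhs I [set y | I - (e / 2)%:E < y].
    apply: open_nbhs_nbhs; split; first exact: open_ereal_gt_ereal.
    have H : I - (e / 2)%:E < I by rewrite lteBlDr// lteDl// lte_fin divr_gt0.
    exact: H.
  by move=> /cv [n _ /(_ n (leqnn n))]; exists n.
have small : \int[mu]_(x in ~` F n) f x < (e / 2)%:E.
  have /esym : \int[mu]_(x in setT) f x =
      \int[mu]_(x in F n) f x + \int[mu]_(x in ~` F n) f x.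
    rewrite -ge0_integral_setU//; first by rewrite setUv.
    - exact: measurableC.
    - by rewrite disj_set2E setICr.
  have : \int[mu]_(x in setT) f x = I.
    rewrite -(setUv (\bigcup_n F n)) ge0_integral_setU//; first by rewrite U0 adde0.
    - exact: measurableC.
    - by rewrite disj_set2E setICr.
  move=> -> E.
  have Fnfin : \int[mu]_(x in F n) f x \is a fin_num.
    rewrite ge0_fin_numE ?integral_ge0//; apply: le_lt_trans ffin.
    exact: ge0_subset_integral.
  by move: In; rewrite lteBlDr// -E lteD2lE.
exists (e / 2 / n.+1%:R)%R; first by rewrite !divr_gt0.
move=> A mA muA.
have : \int[mu]_(x in A) f x <= \int[mu]_(x in A `&` F n) f x + \int[mu]_(x in ~` F n) f x.
  rewrite -ge0_integral_setU//.
  - apply: ge0_subset_integral => //.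
      by apply: measurableU; [exact: measurableI|exact: measurableC].
    by move=> x Ax; have [?|?] := pselect (F n x); [left|right].
  - exact: measurableI.
  - exact: measurableC.
  - by rewrite disj_set2E -setIA setICr setI0.
move=> /le_lt_trans; apply.
rewrite [in ltRHS](splitr e) EFinD; apply: lteD => //.

have : \int[mu]_(x in A `&` F n) f x <= \int[mu]_(x in A `&` F n) (cst n%:R%:E x).
  apply: ge0_le_integral => //; first exact: measurableI.
  - by move=> x [].
move=> /le_lt_trans; apply.
rewrite integral_cst; last exact: measurableI.
have : n%:R%:E * mu (A `&` F n) <= n.+1%:R%:E * mu A.
  apply: lee_pmul => //; rewrite ?lee_fin ?ler0n ?ler_nat//.
  by apply: le_measure; rewrite ?inE//; exact: measurableI.
move=> /le_lt_trans; apply.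
rewrite -lte_pdivlMl// -EFinM mulrC; exact: muA.
Qed.

End AbsoluteContinuity.

(** * The metric on the L1 full group *)

Section L1Metric.
Context {R : realType} {d : measure_display} {X : measurableType d}
  {mu : probability X R} {Phi : set (partial_iso mu)}.
Context {SG : separated_graphing Phi}.
Local Notation dist := (graph_dist Phi).
Local Notation cls := (\pi_(Aut mu))%qT.
Local Notation G := (L1_full_group Phi).
Local Notation rho := (L1_dist Phi).
Local Open Scope ereal_scope.
Implicit Types f g h : mpbij mu.

Lemma mu_lty (A : set X) : measurable A -> mu A < +oo.
Proof. by move=> mA; rewrite (le_lt_trans (probability_le1 mu mA)) ?ltry. Qed.

Lemma cls_mul f g : cls (mpb_mul f g) = (cls f * cls g)%g.
Proof. by rewrite -aut_mulE. Qed.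

Lemma cls_inv f : cls (mpb_V f) = (cls f)^-1%g.
Proof. by rewrite -aut_invE. Qed.

Lemma cls_one : cls (mpb_one mu) = 1%g.
Proof. by []. Qed.

Lemma cls_eq f g : (forall x, f x = g x) -> cls f = cls g.
Proof. by move=> fg; apply/aut_eqP; exact: aeW. Qed.

Lemma integral_mpb f (F : X -> \bar R) (A : set X) : measurable A ->
  measurable_fun setT F -> (forall x, 0 <= F x) ->
  \int[mu]_(x in [set x | A (f x)]) F (f x) = \int[mu]_(x in A) F x.
Proof.
move=> mA mF F0.
rewrite -(ge0_integral_pushforward (mpb_meas f) mu mA) //; last first.
  exact: measurable_funS mF.
apply: eq_measure_integral => [|mf B mB _]; first exact: mpb_meas.
exact: mpb_mu.
Qed.

Lemma integralT_mpb f (F : X -> \bar R) :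
  measurable_fun setT F -> (forall x, 0 <= F x) ->
  \int[mu]_x F (f x) = \int[mu]_x F x.
Proof. by move=> mF F0; exact: (integral_mpb f measurableT mF F0). Qed.

Lemma measurable_dist_mpb f g : measurable_fun setT (fun x => dist (f x) (g x)).
Proof. by apply: measurable_dist; exact: mpb_meas. Qed.

Lemma measurable_displacement f : measurable_fun setT (fun x => dist x (f x)).
Proof. exact: (measurable_dist_mpb (mpb_one mu)). Qed.

Lemma mset_neq f g : measurable [set x | f x <> g x].
Proof.
apply: mset_not.
have -> : [set x | f x = g x] = [set x | setT x /\ f x = g x].
  by apply/seteqP; split => x //= [].
exact: (measurable_eq_on (Phi := Phi) measurableT (mpb_meas f) (mpb_meas g)).
Qed.

Lemma integral_supp (F : X -> \bar R) (E : set X) : measurable E ->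
  measurable_fun setT F -> (forall x, 0 <= F x) -> (forall x, ~ E x -> F x = 0) ->
  \int[mu]_x F x = \int[mu]_(x in E) F x.
Proof.
move=> mE mF F0 FE; rewrite [RHS]integral_mkcond; apply: eq_integral => x _.
by rewrite patchE; case: ifPn => //; rewrite notin_setE => /FE.
Qed.

Lemma rhoE f g : rho (cls f) (cls g) = \int[mu]_x dist (f x) (g x).
Proof.
rewrite /L1_dist /aut_fun; apply: ge0_ae_eq_integral => //.
- exact: measurable_dist_mpb.
- exact: measurable_dist_mpb.
- by move=> x _; exact: dist_ge0.
- by move=> x _; exact: dist_ge0.
- by apply: filterS2 (repr_ae f) (repr_ae g) => x -> -> _.
Qed.

Lemma rho1E f : rho 1%g (cls f) = \int[mu]_x dist x (f x).
Proof. by rewrite -cls_one rhoE. Qed.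

Lemma rhoxx S : rho S S = 0.
Proof. by rewrite /L1_dist; under eq_integral do rewrite distxx; rewrite integral0. Qed.

Lemma rho_sym S T : rho S T = rho T S.
Proof. by apply: eq_integral => x _; exact: dist_sym. Qed.

Lemma rho_tri T S U : rho S U <= rho S T + rho T U.
Proof.
rewrite /L1_dist -ge0_integralD//.
- apply: ge0_le_integral => //.
  + by move=> x _; exact: dist_ge0.
  + exact: measurable_dist_mpb.
  + by apply: emeasurable_funD; exact: measurable_dist_mpb.
  + by move=> x _; exact: dist_tri.
- by move=> x _; exact: dist_ge0.
- exact: measurable_dist_mpb.
- by move=> x _; exact: dist_ge0.
- exact: measurable_dist_mpb.
Qed.

Lemma rho_mulr U S T : rho (S * U)%g (T * U)%g = rho S T.
Proof.
rewrite -[U]reprK -[S]reprK -[T]reprK -!cls_mul !rhoE /=.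
apply: (@integralT_mpb (repr U) (fun x => dist (repr S x) (repr T x))) => [|x].
  exact: measurable_dist_mpb.
exact: dist_ge0.
Qed.

(** An integrable displacement is almost everywhere finite, which already puts [T]
    in the full group. *)
Lemma G_rho1 T : G T <-> rho 1%g T < +oo.
Proof.
rewrite -[T]reprK rho1E; set f := repr T.
have fE : {ae mu, forall x, aut_fun (cls f) x = f x} by exact: repr_ae.
have E : \int[mu]_x dist x (aut_fun (cls f) x) = \int[mu]_x dist x (f x).
  apply: ge0_ae_eq_integral => //; try exact: measurable_displacement.
  - by move=> x _; exact: dist_ge0.
  - by move=> x _; exact: dist_ge0.
  - by apply: filterS fE => x ->.
rewrite /L1_full_group /= E; split => [[]//|fin]; split=> //.
have intf : mu.-integrable setT (fun x => dist x (f x)).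
  apply/integrableP; split; first exact: measurable_displacement.
  by under eq_integral do rewrite gee0_abs ?dist_ge0//.
have aef := integrable_ae measurableT intf.
apply: filterS2 fE aef => x -> /(_ I) fx; apply/graph_dist_lty.
by rewrite ltey_eq fx.
Qed.

Lemma G_cls f : G (cls f) <-> \int[mu]_x dist x (f x) < +oo.
Proof. by rewrite G_rho1 rho1E. Qed.

Lemma G_one : G 1%g. Proof. by apply/G_rho1; rewrite rhoxx. Qed.

Lemma rho_inv T : rho 1%g T^-1%g = rho 1%g T.
Proof. by rewrite -(rho_mulr T) mulVg mul1g rho_sym. Qed.

Lemma G_inv T : G T -> G T^-1%g.
Proof. by rewrite !G_rho1 rho_inv. Qed.

Lemma G_mul S T : G S -> G T -> G (S * T)%g.
Proof.
rewrite !G_rho1 => S1 T1; apply: le_lt_trans (rho_tri T _ _) _.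
by rewrite -[X in _ + rho X _]mul1g rho_mulr lte_add_pinfty.
Qed.

(** Distinct points are at distance at least one. *)
Lemma mu_neq_le f g : mu [set x | f x <> g x] <= rho (cls f) (cls g).
Proof.
rewrite rhoE; set E := [set x | _].
have mE : measurable E by exact: mset_neq.
rewrite -[leLHS]mul1e -(integral_cst mu mE).
apply: (@le_trans _ _ (\int[mu]_(x in E) dist (f x) (g x))).
  apply: ge0_le_integral => //.
  - by apply: measurable_funS (measurable_dist_mpb f g).
  - by move=> x; exact: dist_ge1.
apply: ge0_subset_integral => //; first exact: measurable_dist_mpb.
by move=> x _; exact: dist_ge0.
Qed.

(** Absolute continuity for the displacement of [f], uniform over all
    measure-preserving changes of variable [g]. *)
Lemma displacement_small f : G (cls f) -> forall e : R, (0 < e)%R ->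
  exists2 dl : R, (0 < dl)%R & forall g (A : set X), measurable A -> mu A < dl%:E ->
    \int[mu]_(x in A) dist (g x) (f (g x)) < e%:E.
Proof.
move=> /G_cls Gf e e0.
have [dl dl0 H] := integral_small (measurable_displacement f)
  (fun x => dist_ge0 _ _ _) Gf e0.
exists dl => // g A mA Adl.
have mA' : measurable [set x | A (mpb_inv g x)] by exact: mset_mpbV.
have := H _ mA'; rewrite (mu_mpbV g mA) => /(_ Adl); apply: le_lt_trans.
rewrite -(integral_mpb g mA'); last 2 first.
- exact: measurable_displacement.
- by move=> x; exact: dist_ge0.
rewrite le_eqVlt; apply/orP; left; apply/eqP; congr integral.
by apply/seteqP; split => x /=; rewrite mpb_funK.
Qed.

Lemma rho_le_on f g (E : set X) (F : X -> \bar R) : measurable E ->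
  (forall x, ~ E x -> f x = g x) -> measurable_fun setT F -> (forall x, 0 <= F x) ->
  (forall x, E x -> dist (f x) (g x) <= F x) ->
  rho (cls f) (cls g) <= \int[mu]_(x in E) F x.
Proof.
move=> mE fgE mF F0 le; rewrite rhoE (integral_supp mE).
- apply: ge0_le_integral => //.
  + by move=> x _; exact: dist_ge0.
  + exact: measurable_funS (measurable_dist_mpb f g).
  + exact: measurable_funS mF.
- exact: measurable_dist_mpb.
- by move=> x; exact: dist_ge0.
- by move=> x /fgE ->; rewrite distxx.
Qed.

Lemma rho_restrict_small f : G (cls f) -> forall e : R, (0 < e)%R ->
  exists2 dl : R, (0 < dl)%R & forall g,
    (forall x, g x = f x \/ g x = x) -> mu [set x | g x <> f x] < dl%:E ->
    rho (cls g) (cls f) < e%:E.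
Proof.
move=> Gf e e0; have [dl dl0 H] := displacement_small Gf e0.
exists dl => // g gf gdl.
have mE := mset_neq g f.
apply: le_lt_trans (H (mpb_one mu) _ mE gdl).
apply: rho_le_on => //; first by move=> x /contrapT.
- exact: measurable_displacement.
- by move=> x; exact: dist_ge0.
- by move=> x /=; case: (gf x) => ->.
Qed.

(** [S * T] and [S * U] differ only where [T] and [U] do. This set has measure at
    most [rho T U], and the displacement of [S] has small integral over the two
    images of this set. The bound depends on [S] only, not on [T] and [U]. *)
Lemma rho_mull S : G S -> forall e : R, (0 < e)%R ->
  exists2 dl : R, (0 < dl)%R & forall T U, rho T U < dl%:E ->
    rho (S * T)%g (S * U)%g < e%:E.
Proof.
rewrite -[S]reprK; move: (repr S) => {S} f Gf e e0.
have e3 : (0 < e / 3)%R by rewrite divr_gt0.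
have [dl dl0 H] := displacement_small Gf e3.
exists (Num.min dl (e / 3))%R; first by rewrite lt_min dl0.
move=> T U; rewrite -[T]reprK -[U]reprK; move: (repr T) (repr U) => {T U} g h.
rewrite EFin_min lt_min => /andP[gdl ge].
have mE := mset_neq g h; set E := [set x | _] in mE.
have Edl : mu E < dl%:E by exact: le_lt_trans (mu_neq_le _ _) gdl.
have mD (k : mpbij mu) : measurable_fun setT (fun x => dist (k x) (f (k x))).
  exact: (measurable_dist_mpb k (mpb_mul f k)).
have Gfh : rho (cls (mpb_mul f g)) (cls (mpb_mul f h)) <=
    \int[mu]_(x in E) (dist (g x) (f (g x)) + dist (g x) (h x) + dist (h x) (f (h x))).
  apply: rho_le_on => //.
  - by move=> x /contrapT /= ->.
  - apply: emeasurable_funD => //; apply: emeasurable_funD => //.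
    exact: measurable_dist_mpb.
  - by move=> x; rewrite !adde_ge0 ?dist_ge0.
  - move=> x Ex /=; apply: le_trans (dist_tri _ (h x) _ _) _.
    rewrite leeD2r//; apply: le_trans (dist_tri _ (g x) _ _) _.
    by rewrite (dist_sym _ (f (g x))).
rewrite -!cls_mul; apply: le_lt_trans Gfh _.
have -> : \int[mu]_(x in E) (dist (g x) (f (g x)) + dist (g x) (h x) + dist (h x) (f (h x)))
  = \int[mu]_(x in E) dist (g x) (f (g x)) + \int[mu]_(x in E) dist (g x) (h x)
    + \int[mu]_(x in E) dist (h x) (f (h x)).
  have mDE (k : mpbij mu) : measurable_fun E (fun x => dist (k x) (f (k x))).
    exact: measurable_funS (mD k).
  have mgh : measurable_fun E (fun x => dist (g x) (h x)).
    exact: measurable_funS (measurable_dist_mpb g h).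
  rewrite !ge0_integralD//.
  all: try (by move=> x _; rewrite ?adde_ge0 ?dist_ge0).
  exact: emeasurable_funD.
have -> : e = (e / 3 + e / 3 + e / 3)%R by lra.
rewrite !EFinD; apply: lteD; last exact: H.
apply: lteD; first exact: H.
apply: le_lt_trans ge; rewrite rhoE; apply: ge0_subset_integral => //.
  exact: measurable_dist_mpb.
by move=> x _; exact: dist_ge0.
Qed.

End L1Metric.

(** * Closures of subgroups and the derived subgroup *)

Section Subgroups.
Variable gT : groupType.
Implicit Types (N : set gT) (x y : gT).

Definition subgroup N :=
  [/\ N 1%g, forall x y, N x -> N y -> N (x * y)%g & forall x, N x -> N x^-1%g].

Lemma group_closedE N : group_closed (mem N) <-> subgroup N.
Proof.
split=> [[N1 Nd]|[N1 NM NV]].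
  have N1' : N 1%g by move: N1; rewrite inE.
  have NV x : N x -> N x^-1%g.
    move=> Nx; have := Nd 1%g x; rewrite !inE div1g; exact.
  split=> // x y Nx Ny; have := Nd x y^-1%g; rewrite !inE invgK; apply=> //; exact: NV.
split; first by rewrite inE.
by move=> x y; rewrite !inE => Nx Ny; apply: NM => //; exact: NV.
Qed.

Lemma derived_subgroup_subgroup N : subgroup (derived_subgroup N).
Proof.
split=> [H [/group_closedE[]]//|x y Dx Dy H [HG HR]|x Dx H [HG HR]];
  move: (HG) => /group_closedE[H1 HM HV].
  by apply: HM; [exact: Dx|exact: Dy].
by apply: HV; exact: Dx.
Qed.

Lemma derived_commg N x y : N x -> N y -> derived_subgroup N [~ x, y]%g.
Proof. by move=> Nx Ny H [_ HR]; apply: HR; exists x => //; exists y. Qed.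

Lemma derived_subset N H : subgroup H ->
  (forall x y, N x -> N y -> H [~ x, y]%g) -> derived_subgroup N `<=` H.
Proof.
move=> HG HR x; apply; split; first exact/group_closedE.
by move=> _ [u Nu [v Nv <-]]; exact: HR.
Qed.

Lemma derived_sub N : subgroup N -> derived_subgroup N `<=` N.
Proof.
move=> NG; apply: derived_subset => // x y Nx Ny.
have [N1 NM NV] := NG; rewrite commgEl conjgE.
by apply: (NM _ _ (NV _ Nx)); apply: (NM _ _ (NV _ Ny)); exact: NM.
Qed.

Lemma derived_conjg N x y : subgroup N -> derived_subgroup N x -> N y ->
  derived_subgroup N (x ^ y)%g.
Proof.
move=> NG Dx Ny; have [_ DM _] := derived_subgroup_subgroup N.
have -> : (x ^ y = x * [~ x, y])%g by rewrite commgEl mulVKg.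
by apply: DM => //; apply: derived_commg => //; exact: derived_sub.
Qed.

End Subgroups.

Section ClosureSubgroups.
Context {R : realType} {d : measure_display} {X : measurableType d}
  {mu : probability X R} {Phi : set (partial_iso mu)}.
Context {SG : separated_graphing Phi}.
Local Notation G := (L1_full_group Phi).
Local Notation rho := (L1_dist Phi).
Local Notation clos := (closure_in (L1_dist Phi) (L1_full_group Phi)).
Local Open Scope ereal_scope.
Implicit Types A : set (Aut mu).

Lemma G_subgroup : subgroup G.
Proof. by split; [exact: G_one|exact: G_mul|exact: G_inv]. Qed.

Lemma clos_sub A : clos A `<=` G. Proof. by move=> x []. Qed.

Lemma sub_clos A : A `<=` G -> A `<=` clos A.
Proof.
move=> AG x Ax; split; first exact: AG.
by move=> e e0; exists x; rewrite ?rhoxx ?lte_fin.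
Qed.

Lemma clos_clos A : clos (clos A) = clos A.
Proof.
apply/seteqP; split=> [x [Gx H]|]; last exact/sub_clos/clos_sub.
split=> // e e0; have e2 : (0 < e / 2)%R by rewrite divr_gt0.
have [y [_ /(_ _ e2)[z Az yz] xy]] := H _ e2.
exists z => //; apply: le_lt_trans (rho_tri y _ _) _.
by rewrite (splitr e) EFinD lteD.
Qed.

(** Right translations are isometries and left translations are continuous
    ([rho_mull]). For inverses, translate [rho x y] by [x^-1] on the left and by
    [y^-1] on the right. *)
Lemma clos_subgroup A : A `<=` G -> subgroup A -> subgroup (clos A).
Proof.
move=> AG [A1 AM AV]; split; first exact: sub_clos.
- move=> x y [Gx Hx] [Gy Hy]; split; first exact: G_mul.
  move=> e e0; have e2 : (0 < e / 2)%R by rewrite divr_gt0.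
  have [dl dl0 xdl] := rho_mull Gx e2.
  have [y' Ay' yy'] := Hy _ dl0; have [x' Ax' xx'] := Hx _ e2.
  exists (x' * y')%g; first exact: AM.
  apply: le_lt_trans (rho_tri (x * y')%g _ _) _.
  by rewrite (splitr e) EFinD lteD ?rho_mulr// xdl.
- move=> x [Gx Hx]; split; first exact: G_inv.
  move=> e e0; have [dl dl0 xdl] := rho_mull (G_inv Gx) e0.
  have [y Ay xy] := Hx _ dl0; exists y^-1%g; first exact: AV.
  by rewrite -(rho_mulr y) mulVg -(mulVg x) rho_sym xdl.
Qed.

Lemma clos_conjg A (B : set (Aut mu)) g : G g -> (forall x, A x -> B (x ^ g)%g) ->
  forall x, clos A x -> clos B (x ^ g)%g.
Proof.
move=> Gg Ag x [Gx Hx]; split.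
  by rewrite conjgE; apply: G_mul; [exact: G_inv|exact: G_mul].
move=> e e0; have [dl dl0 H] := rho_mull (G_inv Gg) e0.
have [y Ay xy] := Hx _ dl0; exists (y ^ g)%g; first exact: Ag.
by rewrite !conjgE !mulgA !rho_mulr H.
Qed.

(** Used to approximate [T] by its restrictions to invariant sets. Two left
    translations by fixed elements, [S^-1] and [S^-1 * T^-1 * S], relate the two
    commutators. *)
Lemma commg_small S T : G S -> G T -> forall e : R, (0 < e)%R ->
  exists2 dl : R, (0 < dl)%R & forall T', G T' -> rho T' T < dl%:E ->
    rho [~ S, T']%g [~ S, T]%g < e%:E.
Proof.
move=> GS GT e e0; have e2 : (0 < e / 2)%R by rewrite divr_gt0.
have GVS : G S^-1%g by exact: G_inv.
have GVT : G T^-1%g by exact: G_inv.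
have [d1 d10 H1] := rho_mull (G_mul GVS (G_mul GVT GS)) e2.
have [d2 d20 H2] := rho_mull GVS e2.
have [d3 d30 H3] := rho_mull GVT d20.
exists (Num.min d1 d3)%R; first by rewrite lt_min d10.
move=> T' GT'; rewrite EFin_min lt_min => /andP[T1 T3].
apply: le_lt_trans (rho_tri (S^-1 * (T^-1 * S) * T')%g _ _) _.
have commE (U V : Aut mu) : ([~ U, V] = U^-1 * (V^-1 * U) * V)%g.
  by rewrite commgEl conjgE !mulgA.
rewrite (splitr e) EFinD; apply: lteD; last by rewrite commE H1.
rewrite commE rho_mulr H2// rho_mulr.
by rewrite -(rho_mulr T') mulVg -(mulVg T) rho_sym H3.
Qed.

End ClosureSubgroups.

(** * The orbit relation is generated by countably many involutions *)

Section OrbitMaps.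
Context {R : realType} {d : measure_display} {X : measurableType d}
  {mu : probability X R} {Phi : set (partial_iso mu)}.
Context {SG : separated_graphing Phi}.
Local Notation sep := (sep Phi (separated_graphing := SG)).
Local Notation cls := (\pi_(Aut mu))%qT.
Local Notation G := (L1_full_group Phi).
Local Open Scope ereal_scope.

(** A partial isomorphism restricted to a set [E] that is disjoint from its image
    extends to a global involution, which exchanges [E] with this image [F]. *)
Section PartialInvolution.
Variables (phi : partial_iso mu) (E : set X).
Hypotheses (mE : measurable E) (Edom : E `<=` pi_dom phi)
  (EphiE : forall x, E x -> ~ E (phi x)).

Let F := [set y | pi_rng phi y /\ E (pi_inv phi y)].

Let mF : measurable F.
Proof. by apply: (pi_minv (p := phi)) => //; exact: pi_mrng. Qed.

Let phiF x : E x -> F (phi x).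
Proof.
move=> Ex; split; first by apply: pi_funS; exact: Edom.
by rewrite pi_funK// inE; exact: Edom.
Qed.

Let inv f : X -> X := fun x =>
  if `[< E x >] then phi x else if `[< F x >] then pi_inv phi x else f x.

Let f := inv id.

Let fE x : E x -> f x = phi x. Proof. by move=> Ex; rewrite /f /inv asboolT. Qed.

Let FnE x : F x -> ~ E x.
Proof.
by move=> [rx Ex'] Ex; apply: (EphiE Ex'); rewrite pi_invK// inE.
Qed.

Let fF x : F x -> f x = pi_inv phi x.
Proof. by move=> Fx; rewrite /f /inv asboolF ?asboolT//; exact: FnE. Qed.

Let fC x : ~ E x -> ~ F x -> f x = x.
Proof. by move=> nE nF; rewrite /f /inv !asboolF. Qed.

Let ff : involutive f.
Proof.
move=> x; have [Ex|nE] := pselect (E x).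
  by rewrite (fE Ex) (fF (phiF Ex)) pi_funK// inE; exact: Edom.
have [Fx|nF] := pselect (F x); last by rewrite !fC.
by rewrite (fF Fx) fE; case: Fx => // rx Ex; rewrite pi_invK// inE.
Qed.

Let preimf B : f @^-1` B =
  (E `&` phi @^-1` B `|` F `&` pi_inv phi @^-1` B) `|` (~` (E `|` F) `&` B).
Proof.
apply/seteqP; split => x /=.
  have [Ex|nE] := pselect (E x); first by rewrite (fE Ex); left; left.
  have [Fx|nF] := pselect (F x); first by rewrite (fF Fx); left; right.
  by rewrite fC//; right; split=> // -[].
move=> [[[Ex]|[Fx]]|[nEF]]; rewrite ?(fE Ex) ?(fF Fx)//.
by rewrite fC// => ?; apply: nEF; [left|right].
Qed.

Let m1 B : measurable B -> measurable (E `&` phi @^-1` B).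
Proof.
move=> mB; have := @pi_mfun _ _ _ _ phi.
move=> /(measurable_funS (pi_mdom phi) Edom); exact.
Qed.

Let m2 B : measurable B -> measurable (F `&` pi_inv phi @^-1` B).
Proof.
move=> mB; have FS : F `<=` pi_rng phi by move=> x [].
have := @pi_minv _ _ _ _ phi; move=> /(measurable_funS (pi_mrng phi) FS); exact.
Qed.

Let m3 B : measurable B -> measurable (~` (E `|` F) `&` B).
Proof. by move=> mB; apply: measurableI => //; apply: measurableC; exact: measurableU. Qed.

Let mf : measurable_fun setT f.
Proof.
move=> _ B mB; rewrite setTI preimf.
by apply: measurableU; [apply: measurableU; [exact: m1|exact: m2]|exact: m3].
Qed.

Let muf B : measurable B -> mu (f @^-1` B) = mu B.
Proof.
move=> mB; rewrite preimf.
have -> : mu B = mu ((E `&` B `|` F `&` B) `|` (~` (E `|` F) `&` B)).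
  by congr (mu _); rewrite -!setIUl setUv setTI.
have mEB : measurable (E `&` B) by exact: measurableI.
have mFB : measurable (F `&` B) by exact: measurableI.
have disj (Y Y' : set X) : (forall x, Y x -> Y' x -> False) -> [disjoint Y & Y'].
  by move=> H; rewrite disj_set2E; apply/eqP/seteqP; split => x //= [Yx Y'x]; exact: (H x).
rewrite !measureU//.
all: try (by apply/eqP; rewrite -disj_set2E; apply: disj => x;
  have := @FnE x; rewrite /=; tauto).
- rewrite [X in _ = X + _]addeC; congr (_ + _ + _).
  + apply: etrans _ (@pi_mu _ _ _ _ phi _ mFB _); last by move=> x [[]].
    congr (mu _); apply/seteqP; split => x /= [Ex Bx].
      by split; [exact: Edom|split=> //; exact: phiF].
    case: Bx => -[_]; rewrite pi_funK ?inE// => ? ?; by [].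
  + apply: etrans _ (@pi_V_mu _ _ _ _ phi _ mEB _); last by move=> x [/Edom].
    by congr (mu _); apply/seteqP; split => x /=; rewrite /F /=; tauto.
all: by do ?[exact: m1|exact: m2|exact: m3|apply: measurableU].
Qed.

Lemma partial_involution : exists g : mpbij mu,
  (forall x, E x -> g x = phi x) /\
  forall x, [\/ g x = x, E x /\ g x = phi x |
                [/\ pi_rng phi x, pi_dom phi (pi_inv phi x) & g x = pi_inv phi x]].
Proof.
exists (MPBij ff ff mf mf muf); split => /= [|x]; first exact: fE.
have [Ex|nE] := pselect (E x); first by constructor 2; rewrite fE.
have [Fx|nF] := pselect (F x); last by constructor 1; rewrite fC.
by constructor 3; rewrite (fF Fx); case: Fx => ? Ex; split => //; exact: Edom.
Qed.

End PartialInvolution.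

(** Each generator is cut, up to its fixed points, into the countably many pieces
    on which a separating set contains the point but not its image. *)
Lemma generating_involutions : exists iota : nat * nat -> mpbij mu,
  (forall k x, graph_dist Phi x (iota k x) <= 1) /\
  (forall phi x, symmetrized Phi phi -> pi_dom phi x -> phi x <> x ->
     exists k, iota k x = phi x).
Proof.
have /countable_injP[c cinj] : countable (symmetrized Phi) by exact: countable_symmetrized.
have H (k : nat * nat) : exists g : mpbij mu, (forall x, graph_dist Phi x (g x) <= 1) /\
    forall phi, symmetrized Phi phi -> c phi = k.1 ->
      forall x, pi_dom phi x -> sep k.2 x -> ~ sep k.2 (phi x) -> g x = phi x.
  case: k => n i /=.
  have [[phi [Sphi cphi]]|nphi] :=
    pselect (exists phi, symmetrized Phi phi /\ c phi = n); last first.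
    exists (mpb_one mu); split=> [x|phi Sphi cphi]; first by rewrite distxx.
    by exfalso; apply: nphi; exists phi.
  pose E := [set x | pi_dom phi x /\ (sep i x /\ ~ sep i (phi x))].
  have mE : measurable E.
    have m1 : measurable [set x | pi_dom phi x /\ sep i (phi x)].
      by apply: pi_mfun; [exact: pi_mdom|exact: msep].
    have : measurable [set x | pi_dom phi x /\
        (sep i x /\ ~ (pi_dom phi x /\ sep i (phi x)))].
      apply: mset_and; first exact: pi_mdom.
      by apply: mset_and; [exact: msep|exact: mset_not].
    congr measurable; apply/seteqP; split => x /= [Dx [sx ns]]; do 2 split => //.
      by move=> ?; apply: ns.
    by case.
  have [g [gE gd]] := partial_involution mE (fun x => @proj1 _ _)
    (fun x (Ex : E x) (Ex' : E (phi x)) => Ex.2.2 Ex'.2.1).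
  exists g; split=> [x|psi Spsi cpsi x Dx sx nsx].
    have [->|[[Dx _] ->]|[rx Dx ->]] := gd x; first by rewrite distxx.
      by apply: (@dist_walk _ _ _ _ _ 1%N); exists phi.
    rewrite dist_sym; apply: (@dist_walk _ _ _ _ _ 1%N); exists phi => //; split => //=.
    by rewrite pi_invK// inE.
  have e : psi = phi by apply: cinj; rewrite ?inE// cpsi.
  by rewrite e in Dx sx nsx *; apply: gE.
have [iota iotaP] := choice H.
exists iota; split=> [k|phi x Sphi Dx phix]; first by case: (iotaP k).
have [i [si nsi]] := sepP Phi (nesym phix).
by exists (c phi, i); case: (iotaP (c phi, i)) => _; apply.
Qed.

(** Words in the involutions: a measured form of the Feldman-Moore theorem. Global
    bijections have the advantage over partial ones that they can be composed,
    inverted and integrated against without any care for domains. *)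
Lemma orbit_maps : exists gam : seq (nat * nat) -> mpbij mu,
  [/\ forall w x, orbit_rel Phi (x, gam w x),
      forall w, G (cls (gam w)) &
      forall x y, orbit_rel Phi (x, y) -> exists w, y = gam w x].
Proof.
have [iota [iota1 iotaP]] := generating_involutions.
pose gam := foldr (fun k g => mpb_mul g (iota k)) (mpb_one mu).
have gamd w x : graph_dist Phi x (gam w x) <= (size w)%:R%:E.
  elim: w x => [|k w IH] x /=; first by rewrite distxx.
  apply: le_trans (dist_tri _ (iota k x) _ _) _.
  by rewrite -nat1r EFinD; apply: leeD; [exact: iota1|exact: IH].
exists gam; split=> [w x|w|x y].
- by apply/graph_dist_lty; rewrite (le_lt_trans (gamd w x)) ?ltry.
- apply/G_cls; apply: (@le_lt_trans _ _ (\int[mu]_x (cst (size w)%:R%:E x))).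
    apply: ge0_le_integral => //.
    + by move=> x _; exact: dist_ge0.
    + exact: measurable_displacement.
  rewrite integral_cst// [X in _ * X](_ : _ = 1) ?mule1 ?ltry//.
  exact: probability_setT.
- rewrite orbit_relE => -[n]; elim: n x => [|n IH] x /=; first by exists [::].
  move=> [phi Sphi [Dx /IH[w ->]]].
  have [->|/(iotaP _ _ Sphi Dx)[k <-]] := pselect (phi x = x); first by exists w.
  by exists (k :: w).
Qed.

End OrbitMaps.

(** * Permutations of finitely many pieces *)

Section Pieces.
Context {R : realType} {d : measure_display} {X : measurableType d}
  {mu : probability X R}.
Local Notation cls := (\pi_(Aut mu))%qT.

(** When the sets [e i @` E] are pairwise disjoint, a permutation of the index type
    acts on the space by moving [e i x] to [e (p i) x] for [x] in [E]. All identities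
    between such elements reduce to identities between the index maps. Only
    involutions are considered, so that an index map carries its own inverse. *)
Section PiecePermutation.
Variables (I : finType) (e : I -> mpbij mu) (E : set X).
Hypotheses (mE : measurable E)
  (disj : forall i j x y, E x -> E y -> e i x = e j y -> i = j).

Definition piece_index (y : X) := [pick i | `[< E (mpb_inv (e i) y) >]].

Lemma piece_indexE i x : E x -> piece_index (e i x) = Some i.
Proof.
move=> Ex; rewrite /piece_index; case: pickP => [j /asboolP Ej|/(_ i)].
  by congr Some; apply: (disj Ej Ex); rewrite mpb_invK.
by rewrite mpb_funK asboolT.
Qed.

Variant piece_spec y : option I -> Prop :=
| InPiece i x of E x & y = e i x : piece_spec y (Some i)
| OffPieces of (forall i x, E x -> y <> e i x) : piece_spec y None.

Lemma pieceP y : piece_spec y (piece_index y).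
Proof.
rewrite /piece_index; case: pickP => [i /asboolP Ei|H].
  by apply: (InPiece Ei); rewrite mpb_invK.
apply: OffPieces => i x Ex yE; have := H i.
by rewrite yE mpb_funK asboolT.
Qed.

Definition permute_pieces_fun (p : I -> I) (y : X) : X :=
  if piece_index y is Some i then e (p i) (mpb_inv (e i) y) else y.

Lemma permute_pieces_funE p i x : E x -> permute_pieces_fun p (e i x) = e (p i) x.
Proof. by move=> Ex; rewrite /permute_pieces_fun piece_indexE// mpb_funK. Qed.

Section Involution.
Variables (p : I -> I) (pK : involutive p).

Lemma permute_pieces_funK : involutive (permute_pieces_fun p).
Proof.
move=> y; rewrite {2}/permute_pieces_fun; case: pieceP => [i x Ex ->|nE].
  by rewrite mpb_funK permute_pieces_funE// pK.
by rewrite /permute_pieces_fun; case: pieceP => // i x Ex /(nE _ _ Ex).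
Qed.

Let piece_set (k : option I) : set X :=
  if k is Some i then [set y | E (mpb_inv (e i) y)]
  else [set y | forall i, ~ E (mpb_inv (e i) y)].

Let piece_map (k : option I) : mpbij mu :=
  if k is Some i then mpb_mul (e (p i)) (mpb_V (e i)) else mpb_one mu.

Let measurable_piece_set k : measurable (piece_set k).
Proof.
case: k => [i|] /=; first exact: mset_mpbV.
by apply: mset_all => i; apply: mset_not; exact: mset_mpbV.
Qed.

Let cover_piece_set y : exists k, piece_set k y.
Proof.
have [[i Ei]|nE] := pselect (exists i, E (mpb_inv (e i) y)); first by exists (Some i).
by exists None => i Ei; apply: nE; exists i.
Qed.

Let piece_mapE k y : piece_set k y -> permute_pieces_fun p y = piece_map k y.
Proof.
case: k => [i Ei|nE] /=.
  by rewrite -{1}[y](mpb_invK (e i)) permute_pieces_funE.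
rewrite /permute_pieces_fun; case: pieceP => // i x Ex yE.
by case: (nE i); rewrite yE mpb_funK.
Qed.

Definition permute_pieces : mpbij mu :=
  glue permute_pieces_funK permute_pieces_funK measurable_piece_set
    cover_piece_set piece_mapE.

Lemma permute_piecesE i x : E x -> permute_pieces (e i x) = e (p i) x.
Proof. exact: permute_pieces_funE. Qed.

Lemma permute_pieces_off y : (forall i x, E x -> y <> e i x) -> permute_pieces y = y.
Proof.
by move=> nE; rewrite /= /permute_pieces_fun; case: pieceP => // i x Ex /(nE _ _ Ex).
Qed.

Lemma permute_piecesP y : permute_pieces y = y \/
  exists i x, [/\ E x, y = e i x & permute_pieces y = e (p i) x].
Proof.
have [[i [x [Ex ->]]]|nE] := pselect (exists i x, E x /\ y = e i x).
  by right; exists i, x; split => //; exact: permute_piecesE.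
by left; apply: permute_pieces_off => i x Ex yE; apply: nE; exists i, x.
Qed.

Lemma permute_pieces_inv : (cls permute_pieces)^-1%g = cls permute_pieces.
Proof. by rewrite -cls_inv; apply: cls_eq. Qed.

End Involution.

Lemma permute_pieces_comm p q r (pK : involutive p) (qK : involutive q)
    (rK : involutive r) : (forall i, r i = p (q (p (q i)))) ->
  cls (permute_pieces rK) = [~ cls (permute_pieces pK), cls (permute_pieces qK)]%g.
Proof.
move=> rE; rewrite commgEl conjgE !permute_pieces_inv.
set P := permute_pieces pK; set Q := permute_pieces qK.
transitivity (cls (mpb_mul P (mpb_mul Q (mpb_mul P Q)))); last by rewrite !cls_mul.
apply: cls_eq => y /=; have [[i [x [Ex ->]]]|nE] := pselect (exists i x, E x /\ y = e i x).
  by rewrite !permute_pieces_funE// rE.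
have nE' i x : E x -> y <> e i x by move=> Ex yE; apply: nE; exists i, x.
have off s (sK : involutive s) : permute_pieces_fun s y = y.
  exact: (permute_pieces_off sK).
by rewrite !off.
Qed.

Lemma permute_pieces_conj p q r (pK : involutive p) (qK : involutive q)
    (rK : involutive r) : (forall i, r i = q (p (q i))) ->
  cls (permute_pieces rK) = (cls (permute_pieces pK) ^ cls (permute_pieces qK))%g.
Proof.
move=> rE; rewrite conjgE !permute_pieces_inv.
set P := permute_pieces pK; set Q := permute_pieces qK.
transitivity (cls (mpb_mul Q (mpb_mul P Q))); last by rewrite !cls_mul.
apply: cls_eq => y /=; have [[i [x [Ex ->]]]|nE] := pselect (exists i x, E x /\ y = e i x).
  by rewrite !permute_pieces_funE// rE.
have nE' i x : E x -> y <> e i x by move=> Ex yE; apply: nE; exists i, x.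
have off s (sK : involutive s) : permute_pieces_fun s y = y.
  exact: (permute_pieces_off sK).
by rewrite !off.
Qed.

End PiecePermutation.

Let if_bool (T : mpbij mu) (b : bool) := if b then T else mpb_one mu.

Let swap_disj (T : mpbij mu) (C : set X) : (forall x, C x -> ~ C (T x)) ->
  forall i j x y, C x -> C y -> if_bool T i x = if_bool T j y -> i = j.
Proof.
move=> CT [] [] x y //= Cx Cy; first by move=> E; case: (CT _ Cx); rewrite E.
by move=> E; case: (CT _ Cy); rewrite -E.
Qed.

(** Defined for all [T] and [C], with the identity as default value unless [C] is
    measurable and disjoint from its image, so that no proof occurs in the term. *)
Definition swap (T : mpbij mu) (C : set X) : mpbij mu :=
  match pselect (measurable C /\ forall x, C x -> ~ C (T x)) with
  | left h => permute_pieces (proj1 h) (swap_disj (proj2 h)) negbK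
  | right _ => mpb_one mu
  end.

Section Swap.
Variables (T : mpbij mu) (C : set X).
Hypotheses (mC : measurable C) (CT : forall x, C x -> ~ C (T x)).

Lemma swap_dom x : C x -> swap T C x = T x.
Proof.
rewrite /swap; case: pselect => [h Cx|[]//].
exact: (permute_piecesE (proj1 h) (swap_disj (proj2 h)) negbK false).
Qed.

Lemma swap_img x : C x -> swap T C (T x) = x.
Proof.
rewrite /swap; case: pselect => [h Cx|[]//].
exact: (permute_piecesE (proj1 h) (swap_disj (proj2 h)) negbK true).
Qed.

Lemma swap_off x : ~ C x -> ~ C (mpb_inv T x) -> swap T C x = x.
Proof.
rewrite /swap; case: pselect => [h nC nCT|[]//].
apply: permute_pieces_off => -[] y Cy xE; last by apply: nC; rewrite xE.
by apply: nCT; rewrite xE mpb_funK.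
Qed.

Lemma swap_unique (f : mpbij mu) : (forall x, C x -> f x = T x) ->
  (forall x, C x -> f (T x) = x) ->
  (forall x, ~ C x -> ~ C (mpb_inv T x) -> f x = x) -> cls f = cls (swap T C).
Proof.
move=> fC fT foff; apply: cls_eq => x.
have [Cx|nC] := pselect (C x); first by rewrite fC// swap_dom.
have [Cx|nCT] := pselect (C (mpb_inv T x)); last by rewrite foff// swap_off.
by rewrite -[x](mpb_invK T) fT// swap_img.
Qed.

End Swap.

Lemma swapP (T : mpbij mu) (C : set X) x :
  [\/ swap T C x = x, swap T C x = T x | swap T C x = mpb_inv T x].
Proof.
have [[mC CT]|h] := pselect (measurable C /\ forall x, C x -> ~ C (T x)); last first.
  by constructor 1; rewrite /swap; case: pselect.
have [Cx|nC] := pselect (C x); first by constructor 2; rewrite swap_dom.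
have [Cx|nCT] := pselect (C (mpb_inv T x)); last by constructor 1; rewrite swap_off.
by constructor 3; rewrite -{1}[x](mpb_invK T) swap_img.
Qed.

(** This makes the exchanges a conjugation-invariant family. *)
Lemma swap_conjg (T h : mpbij mu) (C : set X) : measurable C ->
  (forall x, C x -> ~ C (T x)) ->
  (cls (swap T C) ^ cls h)%g =
  cls (swap (mpb_mul (mpb_V h) (mpb_mul T h)) [set x | C (h x)]).
Proof.
move=> mC CT; rewrite conjgE -cls_inv.
transitivity (cls (mpb_mul (mpb_V h) (mpb_mul (swap T C) h))); first by rewrite !cls_mul.
apply: swap_unique => /=; first exact: mset_mpb.
- by move=> x Cx; rewrite mpb_invK; exact: CT.
- by move=> x Cx; rewrite swap_dom.
- by move=> x Cx; rewrite mpb_invK swap_img// mpb_funK.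
- by move=> x nC; rewrite mpb_invK => nCT; rewrite swap_off// mpb_funK.
Qed.

End Pieces.

Section PiecesL1.
Context {R : realType} {d : measure_display} {X : measurableType d}
  {mu : probability X R} {Phi : set (partial_iso mu)}.
Context {SG : separated_graphing Phi}.
Local Notation cls := (\pi_(Aut mu))%qT.
Local Notation G := (L1_full_group Phi).
Local Open Scope ereal_scope.

(** The displacement of [f] is dominated by the sum of those of the [h k]. *)
Lemma G_finite_choice (K : finType) (h : K -> mpbij mu) (f : mpbij mu) :
  (forall k, G (cls (h k))) -> (forall x, exists k, f x = h k x) -> G (cls f).
Proof.
move=> Gh fh; apply/G_cls.
apply: (@le_lt_trans _ _ (\int[mu]_x (\sum_(k <- index_enum K) graph_dist Phi x (h k x)))).
  apply: ge0_le_integral => //.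
  - by move=> x _; exact: dist_ge0.
  - exact: measurable_displacement.
  - by apply: emeasurable_sum => k; exact: measurable_displacement.
  - move=> x _; have [k ->] := fh x.
    rewrite (bigD1 k)//= leeDl// sume_ge0// => j _; exact: dist_ge0.
rewrite ge0_integral_sum//.
- by apply: lte_sum_pinfty => k _; apply/G_cls.
- by move=> k; exact: measurable_displacement.
- by move=> k x _; exact: dist_ge0.
Qed.

Lemma G_permute_pieces (I : finType) (e : I -> mpbij mu) (E : set X)
  (mE : measurable E) (disj : forall i j x y, E x -> E y -> e i x = e j y -> i = j)
  (p : I -> I) (pK : involutive p) :
  (forall i, G (cls (e i))) -> G (cls (permute_pieces mE disj pK)).
Proof.
move=> Ge.
apply: (@G_finite_choice (option (I * I))
  (fun k => if k is Some ij then mpb_mul (e ij.1) (mpb_V (e ij.2)) else mpb_one mu)).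
  case=> [[i j]|] /=; last exact: G_one.
  by rewrite cls_mul cls_inv; apply: G_mul => //; exact: G_inv.
move=> x; have [->|[i [y [Ey -> ->]]]] := permute_piecesP mE disj pK x.
  by exists None.
by exists (Some (p i, i)); rewrite /= mpb_funK.
Qed.

Lemma G_swap (T : mpbij mu) (C : set X) : G (cls T) -> G (cls (swap T C)).
Proof.
move=> GT.
apply: (@G_finite_choice (option bool)
  (fun k => if k is Some b then if b then T else mpb_V T else mpb_one mu)).
  by case=> [[]|] //; [rewrite cls_inv; exact: G_inv|exact: G_one].
move=> x; have [->|->|->] := swapP T C x; first by exists None.
  by exists (Some true).
by exists (Some false).
Qed.

End PiecesL1.

(** * Topological simplicity implies ergodicity *)

Section NullSets.
Context {R : realType} {d : measure_display} {X : measurableType d}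
  {mu : probability X R}.
Local Open Scope ereal_scope.

Lemma ae_null (P : X -> Prop) : measurable [set x | P x] ->
  {ae mu, forall x, ~ P x} <-> mu [set x | P x] = 0.
Proof.
move=> mP; rewrite -(negligibleP mu mP); split; apply: negligibleS => x /=.
  by move=> Px; apply.
by move=> /contrapT.
Qed.

Lemma positive_piece (K : countType) (E : K -> set X) (A : set X) :
  measurable A -> (forall k, measurable (E k)) -> 0 < mu A ->
  {ae mu, forall x, A x -> exists k, E k x} -> exists k, 0 < mu (A `&` E k).
Proof.
move=> mA mE A0 AE; apply: contrapT => nE.
have E0 k : mu (A `&` E k) = 0.
  apply/eqP; rewrite eq_le measure_ge0 andbT leNgt; apply/negP => H.
  by apply: nE; exists k.
pose F n := if unpickle n is Some k then A `&` E k else set0.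
have : mu.-negligible (\bigcup_n F n).
  apply: negligible_bigcup => n; rewrite /F.
  case: (unpickle n) => [k|]; last exact: negligible_set0.
  by apply/negligibleP; [exact: measurableI|exact: E0].
move=> /(negligibleU AE) NN; have : mu A = 0.
  apply/negligibleP => //; apply: negligibleS NN => x Ax.
  have [[k Ek]|nk] := pselect (exists k, E k x); last by left => /(_ Ax).
  by right; exists (pickle k) => //; rewrite /F pickleK.
by move=> A0'; rewrite A0' ltxx in A0.
Qed.

End NullSets.

Section SimpleErgodic.
Context {R : realType} {d : measure_display} {X : measurableType d}
  {mu : probability X R} {Phi : set (partial_iso mu)}.
Context {SG : separated_graphing Phi}.
Local Notation sep := (sep Phi (separated_graphing := SG)).
Local Notation cls := (\pi_(Aut mu))%qT.
Local Notation G := (L1_full_group Phi).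
Local Notation rho := (L1_dist Phi).
Local Notation clos := (closure_in (L1_dist Phi) (L1_full_group Phi)).
Local Notation Dbar := (clos (derived_subgroup G)).
Local Open Scope ereal_scope.

Definition fixes_off (A : set X) (T : Aut mu) := {ae mu, forall x, ~ A x -> T x = x}.

Lemma fixes_off_cls A (f : mpbij mu) :
  fixes_off A (cls f) <-> {ae mu, forall x, ~ A x -> f x = x}.
Proof.
have fE : {ae mu, forall x, aut_fun (cls f) x = f x} by exact: repr_ae.
by split; apply: filterS2 fE => x ->.
Qed.

(** Orbits have at least three points, so on a set of positive measure two orbit
    maps give three disjoint pieces; two transpositions of three pieces do not
    commute. The set [N] absorbs the difference between [A] and an invariant set. *)
Lemma nontrivial_commutator (A B N : set X) : aperiodic Phi ->
  measurable A -> 0 < mu A -> saturated Phi B -> measurable N -> mu N = 0 ->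
  A `+` B `<=` N ->
  exists2 c : Aut mu, derived_subgroup G c & fixes_off A c /\
    exists2 E : set X, measurable E /\ E `<=` A &
      0 < mu E /\ {ae mu, forall x, E x -> c x <> x}.
Proof.
move=> ap mA A0 satB mN N0 ABN.
have [gam [gamO gamG gamX]] := orbit_maps (Phi := Phi).
pose V (k : (seq (nat * nat) * seq (nat * nat)) * (nat * nat * nat)) : set X :=
  let: ((v, w), (a, b, c)) := k in
  [set x | [/\ ~ N x, sep a x /\ ~ sep a (gam v x), sep b x /\ ~ sep b (gam w x) &
               sep c (gam v x) /\ ~ sep c (gam w x)]].
have ms i f : measurable [set x | sep i ((f : mpbij mu) x)].
  by apply: mset_mpb; exact: msep.
have mV k : measurable (V k).
  case: k => [[v w] [[a b] c]].
  have : measurable [set x | ~ N x /\ ((sep a x /\ ~ sep a (gam v x)) /\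
     ((sep b x /\ ~ sep b (gam w x)) /\ (sep c (gam v x) /\ ~ sep c (gam w x))))].
    by repeat first [exact: mset_not|apply: mset_and|exact: ms|exact: msep].
  by congr measurable; apply/seteqP; split => x /=; [move=> [? [? []]]|move=> []].
have AV : {ae mu, forall x, A x -> exists k, V k x}.
  have aeN : {ae mu, forall x, ~ N x} by apply/ae_null.
  apply: filterS2 aeN ap => x nN infx Ax.
  have pick (F : set X) : finite_set F -> exists2 y, orbit_rel Phi (x, y) & ~ F y.
    move=> finF; apply: contrapT => H; apply: infx; apply: sub_finite_set finF => y /= xy.
    by apply: contrapT => nF; apply: H; exists y.
  have [y xy yx] := pick [set x] (finite_set1 x).
  have [z xz zxy] := pick [set x; y] (finite_set2 x y).
  have [v yE] := gamX _ _ xy; have [w zE] := gamX _ _ xz.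
  have [a [ax ay]] := sepP Phi (nesym yx).
  have [b [bx bz]] := sepP Phi (fun e : x = z => zxy (or_introl (esym e))).
  have [c [cy cz]] := sepP Phi (fun e : y = z => zxy (or_intror (esym e))).
  by exists ((v, w), (a, b, c)); rewrite /V /= -yE -zE.
have [[[v w] [[a b] c]] E0] := positive_piece mA mV A0 AV.
set E := _ `&` _ in E0; have mE : measurable E by exact: measurableI.
pose e (i : option bool) : mpbij mu :=
  if i is Some t then gam (if t then w else v) else mpb_one mu.
have disj i j x y : E x -> E y -> e i x = e j y -> i = j.
  move=> [_ [_ [ax av] [bx bw] [cv cw]]] [_ [_ [ax' av'] [bx' bw'] [cv' cw']]].
  case: i j => [[]|] [[]|]//= e1; exfalso.
  - by apply: cw; rewrite e1.
  - by apply: bw; rewrite e1.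
  - by apply: cw'; rewrite -e1.
  - by apply: av; rewrite e1.
  - by apply: bw'; rewrite -e1.
  - by apply: av'; rewrite -e1.
pose p (i : option bool) :=
  match i with None => Some false | Some false => None | s => s end.
pose q (i : option bool) :=
  match i with None => Some true | Some true => None | s => s end.
have pK : involutive p by case=> [[]|].
have qK : involutive q by case=> [[]|].
have Ge i : G (cls (e i)) by case: i => [t|] /=; [exact: gamG|exact: G_one].
pose P := permute_pieces mE disj pK; pose Q := permute_pieces mE disj qK.
exists [~ cls P, cls Q]%g.
  by apply: derived_commg; exact: G_permute_pieces.
have cE : [~ cls P, cls Q]%g = cls (mpb_mul P (mpb_mul Q (mpb_mul P Q))).
  by rewrite commgEl conjgE !permute_pieces_inv !cls_mul.
have EB x : E x -> B x.
  by move=> [Ax [nN _ _ _]]; apply: contrapT => nB; apply: nN; apply: ABN; left.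
rewrite cE; split; last first.
  exists E; first by split => // x [].
  split=> //; have := repr_ae (mpb_mul P (mpb_mul Q (mpb_mul P Q))).
  apply: filterS => x; rewrite /aut_fun => -> Ex /=.
  have xE : x = e None x by [].
  rewrite xE !permute_pieces_funE//=.
  by case: Ex => _ [_ [ax av] _ _] xx; apply: av; rewrite xx.
apply/fixes_off_cls; have : {ae mu, forall x, ~ N x} by apply/ae_null.
apply: filterS => x nN nA.
have off (s : option bool -> option bool) (sK : involutive s) :
    permute_pieces mE disj sK x = x.
  apply: permute_pieces_off => i y Ey xE; apply: nN; apply: ABN; right; split=> //.
  rewrite xE; apply: (satB y); last exact: EB.
  case: {xE} i => [t|] /=; first exact: gamO.
  by have := gamO [::] y; rewrite orbit_relE => _; rewrite orbit_relE; exists 0%N.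
by move: (off _ pK) (off _ qK) => /= offp offq; rewrite !(offp, offq).
Qed.

Lemma Dbar_subgroup : subgroup Dbar.
Proof.
apply: clos_subgroup; last exact: derived_subgroup_subgroup.
by apply: derived_sub; exact: G_subgroup.
Qed.

(** If [A] is invariant and neither null nor conull, the elements supported on [A]
    form a closed normal subgroup. It is nontrivial and proper because there are
    nontrivial commutators supported on [A] and on its complement. *)
Lemma simple_ergodic : aperiodic Phi -> topologically_simple rho Dbar -> ergodic Phi.
Proof.
move=> ap simple A mA [B satB negAB].
apply: contrapT => /not_orP[A0 A1].
have [N [mN N0 ABN]] := negAB.
have muA : 0 < mu A by rewrite lt_neqAle eq_sym measure_ge0 andbT; exact/eqP.
have muCA : 0 < mu (~` A).
  rewrite probability_setC// sube_gt0 lt_neqAle probability_le1// andbT.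
  exact/eqP.
have aeN : {ae mu, forall x, ~ N x} by apply/ae_null.
have AB x : ~ N x -> A x <-> B x.
  move=> nN; split=> [Ax|Bx]; apply: contrapT => H; apply: nN; apply: ABN.
    by left.
  by right.
have [_ DM DV] := Dbar_subgroup.
pose K : set (Aut mu) := [set T | Dbar T /\ fixes_off A T].
have Kinv T : K T -> K T^-1%g.
  move=> [DT fT]; split; first exact: DV.
  rewrite -[T]reprK -cls_inv; apply/fixes_off_cls.
  by apply: filterS fT => x /= H /H e; rewrite -{1}e /aut_fun mpb_funK.
have KM S T : K S -> K T -> K (S * T)%g.
  move=> [DS fS] [DT fT]; split; first exact: DM.
  rewrite -[S]reprK -[T]reprK -cls_mul; apply/fixes_off_cls.
  by apply: filterS2 fS fT => x /= HS HT nA; rewrite [repr T x](HT nA) [repr S x](HS nA).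
have K1 : K 1%g.
  split; first by case: Dbar_subgroup.
  by rewrite -cls_one; apply/fixes_off_cls; exact: aeW.
have Kconj g x : Dbar g -> K x -> K (x ^ g)%g.
  move=> Dg [Dx fx]; split.
    by rewrite conjgE; apply: (DM _ _ (DV _ Dg)); exact: DM.
  rewrite -[x]reprK -[g]reprK conjgE -cls_inv.
  suff : fixes_off A (cls (mpb_mul (mpb_V (repr g)) (mpb_mul (repr x) (repr g)))).
    by rewrite !cls_mul.
  apply/fixes_off_cls.
  have [[og _] _] := Dg.
  have aeNg := ae_comp (repr g) aeN; have fxg := ae_comp (repr g) fx.
  apply: filterS2 (filterI aeN aeNg) (filterI og fxg) => t [nNt nNgt] [ogt fxgt] nAt.
  have nAgt : ~ A (repr g t).
    move=> /(AB _ nNgt) Bgt; apply: nAt; apply/(AB _ nNt); apply: satB Bgt.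
    by move: ogt; rewrite !orbit_relE => -[n w]; exists n; exact: walk_sym.
  by move: (fxgt nAgt); rewrite /= /aut_fun => ->; rewrite mpb_funK.
have Kclos : closure_in rho Dbar K = K.
  apply/seteqP; split=> [x [Dx Hx]|x Kx]; last first.
    by split=> [|e e0]; [case: Kx|exists x; rewrite ?rhoxx ?lte_fin].
  split=> //; rewrite -[x]reprK; apply/fixes_off_cls; set f := repr x.
  pose D := [set t | ~ A t /\ f t <> t].
  have mD : measurable D.
    apply: mset_and; first exact: mset_not.
    exact: (mset_neq (Phi := Phi) f (mpb_one mu)).
  suff D0 : mu D = 0.
    have := (ae_null mD).2 D0; apply: filterS => t nD nA.
    by apply: contrapT => ft; apply: nD.
  apply/eqP; rewrite eq_le measure_ge0 andbT; apply/lee_addgt0Pr => e e0.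
  rewrite add0e; have [y [Dy fy] xy] := Hx _ e0; set g := repr y.
  apply: ltW; apply: le_lt_trans xy; rewrite -[x]reprK -[y]reprK.
  apply: le_trans (mu_neq_le f g).
  have fgy : {ae mu, forall t, ~ A t -> g t = t} by apply/fixes_off_cls; rewrite reprK.
  have mE : measurable [set t | f t <> g t] by exact: (mset_neq (Phi := Phi)).
  have [Z [mZ Z0 HZ]] := fgy.
  have DE : D `<=` [set t | f t <> g t] `|` Z.
    move=> t [nA ft]; have [gt|ngt] := pselect (g t = t); first by left; rewrite /= gt.
    by right; apply: HZ => /(_ nA).
  rewrite (@le_trans _ _ (mu ([set t | f t <> g t] `|` Z)))//.
    by apply: le_measure; rewrite ?inE//; exact: measurableU.
  by apply: le_trans (measureU2 mu mE mZ) _; rewrite [X in _ + X](_ : _ = 0) ?adde0.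
have [cA DcA [fcA [EA [mEA EAA] [EA0 cEA]]]] :=
  nontrivial_commutator ap mA muA satB mN N0 ABN.
have satCB : saturated Phi (~` B).
  move=> x y xy nB By; apply: nB; apply: satB By.
  by move: xy; rewrite !orbit_relE => -[n w]; exists n; exact: walk_sym.
have CABN : (~` A) `+` (~` B) `<=` N.
  by move=> x H; apply: ABN; case: H => -[] /= H /contrapT H'; [right|left].
have [cC DcC [fcC [EC [mEC ECC] [EC0 cEC]]]] :=
  nontrivial_commutator ap (measurableC mA) muCA satCB mN N0 CABN.
have contra (E : set X) (P : X -> Prop) : measurable E -> 0 < mu E ->
    {ae mu, forall x, E x -> P x} -> {ae mu, forall x, E x -> ~ P x} -> False.
  move=> mE E0 aP aN; have : {ae mu, forall x, ~ E x}.
    by apply: filterS2 aP aN => x HP HN Ex; exact: HN Ex (HP Ex).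
  by move/(ae_null mE) => E0'; rewrite -[X in _ < X]/(mu [set x | E x]) E0' ltxx in E0.
have subD : derived_subgroup G `<=` Dbar.
  by apply: sub_clos; apply: derived_sub; exact: G_subgroup.
have [] := simple K.
- by move=> x [].
- by apply/group_closedE; split.
- exact: Kconj.
- exact: Kclos.
- move=> K1E; have : K cA by split=> //; exact: subD.
  rewrite K1E /= => cA1; apply: (contra _ _ mEA EA0 cEA).
  rewrite cA1 -cls_one; have := repr_ae (mpb_one mu).
  by apply: filterS => x; rewrite /aut_fun => -> _; apply.
- move=> KE; have [_ fC] : K cC by rewrite KE; exact: subD.
  apply: (contra _ _ mEC EC0 cEC); apply: filterS fC => x H /ECC nA; apply; exact: H.
Qed.

End SimpleErgodic.

(** * Ergodicity and non-atomicity *)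

Section Ergodic.
Context {R : realType} {d : measure_display} {X : measurableType d}
  {mu : probability X R} {Phi : set (partial_iso mu)}.
Context {SG : separated_graphing Phi}.
Local Open Scope ereal_scope.

Lemma orbit_refl x : orbit_rel Phi (x, x).
Proof. by rewrite orbit_relE; exists 0%N. Qed.

Lemma orbit_sym x y : orbit_rel Phi (x, y) -> orbit_rel Phi (y, x).
Proof. by rewrite !orbit_relE => -[n w]; exists n; exact: walk_sym. Qed.

Lemma orbit_trans y x z : orbit_rel Phi (x, y) -> orbit_rel Phi (y, z) ->
  orbit_rel Phi (x, z).
Proof.
by rewrite !orbit_relE => -[n w] [m w']; exists (n + m)%N; exact: walk_cat w w'.
Qed.

(** The points whose orbit meets [A] form an invariant set containing [A]. *)
Lemma ergodic_meets (K : countType) (gam : K -> mpbij mu) (A : set X) :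
  ergodic Phi -> (forall w x, orbit_rel Phi (x, gam w x)) ->
  (forall x y, orbit_rel Phi (x, y) -> exists w, y = gam w x) ->
  measurable A -> 0 < mu A -> {ae mu, forall x, exists w, A (gam w x)}.
Proof.
move=> erg gamO gamX mA A0; pose Z := [set x | exists w, A (gam w x)].
have mZ : measurable Z by apply: mset_ex => w; exact: mset_mpb.
have satZ : saturated Phi Z.
  move=> x y xy [w Aw]; have [w' E] := gamX _ _ (orbit_trans (orbit_sym xy) (gamO w x)).
  by exists w'; rewrite -E.
have [Z0|Z1] : mu Z = 0 \/ mu Z = 1.
- apply: erg => //; exists Z => //.
  have -> : Z `+` Z = set0 by apply/seteqP; split => x //= [] [].
  exact: negligible_set0.
- exfalso; have AZ : A `<=` Z.
    by move=> x Ax; have [w E] := gamX _ _ (orbit_refl x); exists w; rewrite -E.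
  have := le_measure mu (mem_set mA) (mem_set mZ) AZ.
  by rewrite [leRHS]Z0 leNgt A0.
- have mCZ := measurableC mZ.
  have /(ae_null mCZ) : mu [set x | (~` Z) x] = 0.
    by rewrite -[X in mu X]/(~` Z) probability_setC// [X in 1 - X]Z1 subee.
  by apply: filterS => x /contrapT.
Qed.

Lemma nonatomic_sequence (A : set X) : nonatomic mu -> measurable A -> 0 < mu A ->
  exists F : nat -> set X, [/\ forall n, measurable (F n), forall n, F n `<=` A,
    forall n, 0 < mu (F n) & forall m n x, F m x -> F n x -> m = n].
Proof.
move=> na mA A0.
have H (Y : set X) : exists Z : set X, measurable Y -> 0 < mu Y ->
    [/\ measurable Z, Z `<=` Y, 0 < mu Z & 0 < mu (Y `\` Z)].
  have [[mY Y0]|nY] := pselect (measurable Y /\ 0 < mu Y); last first.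
    by exists set0 => mY Y0; case: nY.
  have [Z [mZ ZY Z0 ZltY]] := na _ mY Y0; exists Z => _ _; split=> //.
  by rewrite measureD// ?(setIidr ZY) ?sube_gt0//; exact: mu_lty.
have [s sP] := choice H.
pose S := fun n => iter n s A.
have SP n : measurable (S n) /\ 0 < mu (S n).
  by elim: n => [//|n [mS S0]] /=; have [] := sP _ mS S0.
have SS m n : (m <= n)%N -> S n `<=` S m.
  move=> /subnK <-; elim: (n - m)%N => [//|k IH] x /=.
  by have [mS S0] := SP (k + m)%N; have [_ ZY _ _] := sP _ mS S0 => /ZY/IH.
exists (fun n => S n `\` S n.+1); split=> [n|n x [/(SS 0%N n (leq0n n))]//|n|].
- by have [mS _] := SP n; have [mS' _] := SP n.+1; exact: measurableD.
- by have [mS S0] := SP n; have [] := sP _ mS S0.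
- suff H' m n x : (m < n)%N -> (S m `\` S m.+1) x -> ~ (S n `\` S n.+1) x.
    move=> m n x Fm Fn; have [lt|lt|//] := ltngtP m n; exfalso.
      exact: (H' _ _ x lt).
    exact: (H' _ _ x lt).
  by move=> lt [_ nS] [/(SS _ _ lt)].
Qed.

End Ergodic.

(** * The double commutator trick *)

Section NormalSubgroup.
Context {R : realType} {d : measure_display} {X : measurableType d}
  {mu : probability X R} {Phi : set (partial_iso mu)}.
Context {SG : separated_graphing Phi}.
Local Notation G := (L1_full_group Phi).
Local Notation clos := (closure_in (L1_dist Phi) (L1_full_group Phi)).
Local Notation D := (derived_subgroup G).
Local Notation Dbar := (clos (derived_subgroup G)).

Variable N : set (Aut mu).
Hypotheses (NG : subgroup N) (ND : N `<=` Dbar)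
  (NJ : forall g x, D g -> N x -> N (x ^ g)%g).

(** The double commutator trick: [[U, T]] is in [N] by normality, hence so is its
    commutator with [V]; since [U ^ T] commutes with [V], this is the commutator of
    [U^-1] and [V] up to conjugation by [U ^ T]. *)
Lemma N_commg U V T : N T -> D U -> D V -> commute (U ^ T)%g V ->
  N [~ U^-1, V]%g.
Proof.
move=> NT DU DV cUV; have [N1 NM NV] := NG.
have [_ DM DI] := derived_subgroup_subgroup G.
have GT : G T by case: (ND NT).
have NW : N (U^-1 * U ^ T)%g.
  have -> : (U^-1 * U ^ T = (T^-1) ^ U * T)%g by rewrite !conjgE !mulgA.
  by apply: NM => //; apply: NJ => //; exact: NV.
have NWV : N [~ U^-1 * U ^ T, V]%g.
  by rewrite commgEl; apply: NM; [exact: NV|exact: NJ].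
have DUT : D (U ^ T)%g by apply: derived_conjg => //; exact: G_subgroup.
have -> : ([~ U^-1, V] = [~ U^-1 * U ^ T, V] ^ (U ^ T)^-1)%g.
  move: (U ^ T)%g cUV {NW NWV DUT} => W cUV.
  have -> : ([~ U^-1 * W, V] = W^-1 * (U * V^-1 * U^-1 * V) * W)%g.
    by rewrite commgEl conjgE invgM invgK !mulgA -(mulgA _ V W) -cUV mulgA.
  by rewrite [RHS]conjgE invgK commgEl conjgE invgK !mulgA mulgV mul1g mulgK.
by apply: NJ => //; exact: DI.
Qed.

End NormalSubgroup.

(** * Even permutations of pieces lie in every nontrivial normal subgroup *)

Section EvenPermutations.
Context {R : realType} {d : measure_display} {X : measurableType d}
  {mu : probability X R} {Phi : set (partial_iso mu)}.
Context {SG : separated_graphing Phi}.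
Local Notation cls := (\pi_(Aut mu))%qT.
Local Notation G := (L1_full_group Phi).
Local Notation D := (derived_subgroup G).
Local Notation Dbar :=
  (closure_in (L1_dist Phi) (L1_full_group Phi) (derived_subgroup G)).
Implicit Types t u v : mpbij mu.

Lemma fixes_off_stable u (A : set X) x : (forall y, ~ A y -> u y = y) -> A x -> A (u x).
Proof.
move=> uA Ax; apply: contrapT => nA; have := uA _ nA.
by move/(can_inj (mpb_funK u)) => e; apply: nA; rewrite e.
Qed.

Lemma commute_disjoint u v t (A : set X) : (forall x, A x -> ~ A (t x)) ->
  (forall x, ~ A x -> u x = x) -> (forall x, ~ A x -> v x = x) ->
  commute (cls u ^ cls t)%g (cls v).
Proof.
move=> At uA vA; rewrite /commute conjgE -cls_inv.
transitivity (cls (mpb_mul (mpb_mul (mpb_V t) (mpb_mul u t)) v)); first by rewrite !cls_mul.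
transitivity (cls (mpb_mul v (mpb_mul (mpb_V t) (mpb_mul u t)))); last by rewrite !cls_mul.
apply: cls_eq => x /=; have [Ax|nAx] := pselect (A x).
  have Avx := fixes_off_stable vA Ax.
  by rewrite (uA _ (At _ Avx)) (uA _ (At _ Ax)) !mpb_funK.
rewrite (vA _ nAx); have [Atx|nAtx] := pselect (A (t x)).
  rewrite vA// => /At; rewrite mpb_invK; apply; exact: fixes_off_stable.
by rewrite uA// mpb_funK vA.
Qed.

Variable N : set (Aut mu).
Hypotheses (NG : subgroup N) (ND : N `<=` Dbar)
  (NJ : forall g x, D g -> N x -> N (x ^ g)%g).

(** The index [inl (b, c)] stands for the piece [T^c (psi^b E)], where [psi] pairs
    two halves of the set to be exchanged with its image under [T]. The index
    [inr (inl (b, c))] stands for a copy of that piece, and [inr (inr c)] for a spare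
    piece, both in the set that a fixed element of [N] moves off itself.

    The exchange of [C] with its image is [tau], an even permutation thanks to the
    pairing. It is the conjugate of its copy [jj] by the transfer [gg], and [gg] is
    the commutator of [ss] and [tt']. The copy [jj] is the commutator of [uu] and [vv],
    which are themselves commutators; the spare pieces are there to make [uu] even. *)
Let J : finType := ((bool * bool) + bool)%type.
Let I : finType := ((bool * bool) + J)%type.

Let tau (i : I) : I := match i with inl (b, c) => inl (b, ~~ c) | _ => i end.
Let gg (i : I) : I :=
  match i with inl bc => inr (inl bc) | inr (inl bc) => inl bc | _ => i end.
Let ss (i : I) : I := match i with
  | inl (false, c) => inr (inl (false, c)) | inr (inl (false, c)) => inl (false, c)
  | _ => i end.
Let tt' (i : I) : I := match i with
  | inl (b, c) => inl (~~ b, c) | inr (inl (b, c)) => inr (inl (~~ b, c))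
  | _ => i end.
Let jj (i : I) : I := match i with inr (inl (b, c)) => inr (inl (b, ~~ c)) | _ => i end.
Let uu (i : I) : I := match i with
  | inr (inl (false, c)) => inr (inl (false, ~~ c)) | inr (inr c) => inr (inr (~~ c))
  | _ => i end.
Let vv (i : I) : I := match i with inr (inl (b, c)) => inr (inl (~~ b, c)) | _ => i end.
Let u1 (i : I) : I := match i with
  | inr (inl (false, c)) => inr (inl (false, ~~ c)) | _ => i end.
Let u2 (i : I) : I := match i with
  | inr (inl (false, c)) => inr (inr c) | inr (inr c) => inr (inl (false, c))
  | _ => i end.
Let v1 (i : I) : I := match i with
  | inr (inl (b, false)) => inr (inl (~~ b, false)) | _ => i end.

Ltac index_cases := by case=> [[[] []]|[[[] []]|[]]].

Let tauK : involutive tau. Proof. index_cases. Qed.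
Let ggK : involutive gg. Proof. index_cases. Qed.
Let ssK : involutive ss. Proof. index_cases. Qed.
Let ttK : involutive tt'. Proof. index_cases. Qed.
Let jjK : involutive jj. Proof. index_cases. Qed.
Let uuK : involutive uu. Proof. index_cases. Qed.
Let vvK : involutive vv. Proof. index_cases. Qed.
Let u1K : involutive u1. Proof. index_cases. Qed.
Let u2K : involutive u2. Proof. index_cases. Qed.
Let v1K : involutive v1. Proof. index_cases. Qed.

Section Pieces.
Variables (e : I -> mpbij mu) (E : set X) (t : mpbij mu) (A : set X).
Hypotheses (mE : measurable E)
  (disj : forall i j x y, E x -> E y -> e i x = e j y -> i = j)
  (Ge : forall i, G (cls (e i))) (Nt : N (cls t))
  (At : forall x, A x -> ~ A (t x)) (eA : forall j x, E x -> A (e (inr j) x)).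

Let perm p (pK : involutive p) := cls (permute_pieces mE disj pK).

Let Gperm p (pK : involutive p) : G (perm pK).
Proof. exact: G_permute_pieces. Qed.

Let off p (pK : involutive p) : (forall bc, p (inl bc) = inl bc) ->
  forall x, ~ A x -> permute_pieces mE disj pK x = x.
Proof.
move=> pl x nAx; have [//|[[bc|j] [y [Ey xE ->]]]] := permute_piecesP mE disj pK x.
  by rewrite xE pl.
by case: nAx; rewrite xE; exact: eA.
Qed.

(** [jj] is in [N] by the double commutator trick, since [uu] and [vv] are elements
    of the derived subgroup supported in [A]. *)
Lemma even_permutation_normal : N (perm tauK).
Proof.
have -> : perm tauK = (perm jjK ^ perm ggK)%g.
  by apply: permute_pieces_conj; index_cases.
apply: NJ.
  have -> : perm ggK = [~ perm ssK, perm ttK]%g.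
    by apply: permute_pieces_comm; index_cases.
  exact: derived_commg.
have -> : perm jjK = [~ (perm uuK)^-1, perm vvK]%g.
  by rewrite permute_pieces_inv; apply: permute_pieces_comm; index_cases.
apply: (N_commg NG ND NJ Nt).
- have -> : perm uuK = [~ perm u1K, perm u2K]%g.
    by apply: permute_pieces_comm; index_cases.
  exact: derived_commg.
- have -> : perm vvK = [~ perm v1K, perm jjK]%g.
    by apply: permute_pieces_comm; index_cases.
  exact: derived_commg.
- by apply: (commute_disjoint At); exact: off.
Qed.

End Pieces.

Lemma paired_swap_normal (T psi t : mpbij mu) (E A : set X)
    (A_ : J -> set X) (w : J -> mpbij mu) :
  let C := [set x | E x \/ E (mpb_inv psi x)] in
  measurable E -> G (cls T) -> G (cls psi) -> (forall j, G (cls (w j))) ->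
  (forall x, E x -> ~ E (psi x)) -> (forall x, C x -> ~ C (T x)) ->
  N (cls t) -> (forall x, A x -> ~ A (t x)) ->
  (forall x, C x -> ~ A x /\ ~ A (T x)) ->
  (forall j, A_ j `<=` A) -> (forall i j x, A_ i x -> A_ j x -> i = j) ->
  (forall j x, E x -> A_ j (w j x)) -> N (cls (swap T C)).
Proof.
move=> C mE GT Gpsi Gw Epsi CT Nt At CA AA Adisj wA.
pose e0 (b : bool) : mpbij mu := if b then psi else mpb_one mu.
pose e (i : I) : mpbij mu :=
  match i with inl (b, c) => if c then mpb_mul T (e0 b) else e0 b | inr j => w j end.
have e0C b x : E x -> C (e0 b x).
  by case: b => Ex; [right; rewrite /= mpb_funK|left].
have e0disj b b' x y : E x -> E y -> e0 b x = e0 b' y -> b = b'.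
  case: b b' => [] [] //= Ex Ey xy; exfalso.
    by apply: (Epsi _ Ex); rewrite xy.
  by apply: (Epsi _ Ey); rewrite -xy.
have disj i j x y : E x -> E y -> e i x = e j y -> i = j.
  move=> Ex Ey; case: i j => [[b []]|i] [[b' []]|j] /=.
  - by move=> /(can_inj (mpb_funK T))/(e0disj _ _ _ _ Ex Ey) ->.
  - by move=> xy; case: (CT _ (e0C b _ Ex)); rewrite xy; exact: e0C.
  - by move=> xy; case: (CA _ (e0C b _ Ex)) => _; rewrite xy; case; exact: AA (wA _ _ Ey).
  - by move=> xy; case: (CT _ (e0C b' _ Ey)); rewrite -xy; exact: e0C.
  - by move=> /(e0disj _ _ _ _ Ex Ey) ->.
  - by move=> xy; case: (CA _ (e0C b _ Ex)); rewrite xy; case; exact: AA (wA _ _ Ey).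
  - by move=> xy; case: (CA _ (e0C b' _ Ey)) => _; rewrite -xy; case; exact: AA (wA _ _ Ex).
  - by move=> xy; case: (CA _ (e0C b' _ Ey)); rewrite -xy; case; exact: AA (wA _ _ Ex).
  - by move=> xy; congr inr; apply: (Adisj _ _ (w i x)); [exact: wA|rewrite xy; exact: wA].
have Ge i : G (cls (e i)).
  case: i => [[b c]|j] //=.
  have Ge0 : G (cls (e0 b)) by case: b => //=; exact: G_one.
  by case: c => //; rewrite cls_mul; exact: G_mul.
have CE x : C x -> exists b y, E y /\ x = e0 b y.
  case=> Ex; first by exists false, x.
  by exists true, (mpb_inv psi x); split=> //=; rewrite mpb_invK.
have mC : measurable C by apply: mset_or => //; exact: mset_mpbV.
rewrite -(@swap_unique _ _ _ _ T C mC CT (permute_pieces mE disj tauK)) //.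
- by apply: (even_permutation_normal (A := A) (t := t)) => // j x Ex; exact: AA (wA _ _ Ex).
- move=> x /CE[b [y [Ey ->]]].
  exact: (permute_piecesE mE disj tauK (inl (b, false)) Ey).
- move=> x /CE[b [y [Ey ->]]].
  exact: (permute_piecesE mE disj tauK (inl (b, true)) Ey).
- move=> x nC nCT; have [//|[[[b c]|j] [y [Ey xE ->]]]] := permute_piecesP mE disj tauK x.
    case: c xE => xE; last by case: nC; rewrite xE; exact: e0C.
    by case: nCT; rewrite xE /= mpb_funK; exact: e0C.
  by rewrite xE.
Qed.

End EvenPermutations.

(** * Every involution lies in every nontrivial closed normal subgroup *)

Section SwapCalculus.
Context {R : realType} {d : measure_display} {X : measurableType d}
  {mu : probability X R}.
Local Notation cls := (\pi_(Aut mu))%qT.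
Variables (T : mpbij mu) (C0 : set X).
Hypothesis (CT : forall x, C0 x -> ~ C0 (T x)).
Local Open Scope ereal_scope.

Let sub_CT (C : set X) : C `<=` C0 -> forall x, C x -> ~ C (T x).
Proof. by move=> CC x Cx CTx; apply: (CT (CC _ Cx)); exact: CC. Qed.

Lemma swap_ext (C C' : set X) x : C `<=` C0 -> C' `<=` C0 ->
  measurable C -> measurable C' ->
  (C x <-> C' x) -> (C (mpb_inv T x) <-> C' (mpb_inv T x)) ->
  swap T C x = swap T C' x.
Proof.
move=> CC CC' mC mC' e1 e2; have CT1 := sub_CT CC; have CT2 := sub_CT CC'.
have [Cx|nC] := pselect (C x); first by rewrite !swap_dom//; exact/e1.
have [CTx|nCT] := pselect (C (mpb_inv T x)).
  by rewrite -{1 2}[x](mpb_invK T) !swap_img//; exact/e2.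
by rewrite !swap_off//; [move/e1|move/e2].
Qed.

Lemma swapU (C C' : set X) : C `<=` C0 -> C' `<=` C0 ->
  measurable C -> measurable C' -> (forall x, C x -> ~ C' x) ->
  cls (swap T [set x | C x \/ C' x]) = (cls (swap T C) * cls (swap T C'))%g.
Proof.
move=> CC CC' mC mC' dis; have CT1 := sub_CT CC; have CT2 := sub_CT CC'.
have sC : [set x | C x \/ C' x] `<=` C0 by move=> x [/CC|/CC'].
rewrite -cls_mul; apply/esym/swap_unique => [|||x|x] /=.
- exact: measurableU.
- exact: sub_CT.
- move=> x [Cx|Cx].
    rewrite (swap_off mC' CT2 (dis _ Cx)) ?swap_dom// => C'T.
    by apply: (CT (CC' _ C'T)); rewrite mpb_invK; exact: CC.
  rewrite (swap_dom mC' CT2 Cx) swap_off//.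
    by move=> CTx; apply: (CT (CC' _ Cx)); exact: CC.
  by rewrite mpb_funK => /dis.
- case=> Cx.
    rewrite (swap_off mC' CT2) ?swap_img//.
      by move=> CTx; apply: (CT (CC _ Cx)); exact: CC'.
    by rewrite mpb_funK; exact: dis.
  rewrite (swap_img mC' CT2 Cx) swap_off//; first by move/dis.
  by move=> CTx; apply: (CT (CC _ CTx)); rewrite mpb_invK; exact: CC'.
- move=> /not_orP[nC nC'] /not_orP[nCT nCT'].
  by rewrite (swap_off mC' CT2)// swap_off.
Qed.

Lemma swap0 : cls (swap T set0) = 1%g.
Proof. by rewrite -cls_one; apply/esym/swap_unique. Qed.

End SwapCalculus.

Section SwapNormal.
Context {R : realType} {d : measure_display} {X : measurableType d}
  {mu : probability X R} {Phi : set (partial_iso mu)}.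
Context {SG : separated_graphing Phi}.
Local Notation sep := (sep Phi (separated_graphing := SG)).
Local Notation cls := (\pi_(Aut mu))%qT.
Local Notation G := (L1_full_group Phi).
Local Notation D := (derived_subgroup G).
Local Notation rho := (L1_dist Phi).
Local Notation Dbar :=
  (closure_in (L1_dist Phi) (L1_full_group Phi) (derived_subgroup G)).
Local Open Scope ereal_scope.

Variable N : set (Aut mu).
Hypotheses (NG : subgroup N) (ND : N `<=` Dbar)
  (NJ : forall g x, D g -> N x -> N (x ^ g)%g)
  (Ncl : closure_in rho Dbar N = N).

Lemma N_limit x : G x ->
  (forall e : R, (0 < e)%R -> exists2 y, N y & rho x y < e%:E) -> N x.
Proof.
move=> Gx Hx; rewrite -Ncl; split=> //; rewrite -clos_clos; split=> //.
by move=> e /Hx[y /ND Dy xy]; exists y.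
Qed.

Section Additivity.
Variables (T : mpbij mu) (C0 : set X).
Hypotheses (GT : G (cls T)) (CT : forall x, C0 x -> ~ C0 (T x)).

(** The exchange over a disjoint union is the limit of the finite products of the
    exchanges over the parts, because a fixed element has small displacement over
    the remaining small set. *)
Lemma swap_normal_sum (F : nat -> set X) (C : set X) :
  (forall n, measurable (F n)) -> (forall n, F n `<=` C0) ->
  (forall m n x, F m x -> F n x -> m = n) ->
  measurable C -> C `<=` C0 -> {ae mu, forall x, C x <-> exists n, F n x} ->
  (forall n, N (cls (swap T (F n)))) -> N (cls (swap T C)).
Proof.
move=> mF FC0 disF mC CC0 aeC NF.
have [N1 NM NV] := NG.
pose U n := [set x | exists k, (k < n)%N /\ F k x].
have mU n : measurable (U n).
  by apply: mset_ex => k; apply: mset_and; [exact: mset_const|exact: mF].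
have UC0 n : U n `<=` C0 by move=> x [k [_ /FC0]].
have NU n : N (cls (swap T (U n))).
  elim: n => [|n IH].
    have -> : U 0%N = set0 by apply/seteqP; split => x //= [k []].
    by rewrite swap0.
  have -> : U n.+1 = [set x | U n x \/ F n x].
    apply/seteqP; split => x /=.
      move=> [k [kn Fk]]; move: kn; rewrite ltnS leq_eqVlt.
      move=> /orP[/eqP <-|kn]; first by right.
      by left; exists k.
    by case=> [[k [kn Fk]]|Fn]; [exists k; split=> //; exact: ltnW|exists n].
  rewrite (swapU CT)//; first exact: NM.
  by move=> x [k [kn Fk]] /(disF _ _ _ Fk) e; rewrite e ltnn in kn.
pose C' := [set x | exists n, F n x].
have mC' : measurable C' by apply: mset_ex.
have C'C0 : C' `<=` C0 by move=> x [n /FC0].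
have -> : cls (swap T C) = cls (swap T C').
  apply/aut_eqP; apply: filterS2 aeC (ae_comp (mpb_V T) aeC) => x e1 e2.
  exact: (swap_ext CT).
have GC' : G (cls (swap T C')) by exact: G_swap.
apply: N_limit => // e e0.
have [dl dl0 Hdl] := rho_restrict_small GC' e0.
have dl2 : (0 < dl / 2)%R by rewrite divr_gt0.
have mW n : measurable [set x | C' x /\ ~ U n x].
  by apply: mset_and; [exact: mC'|apply: mset_not; exact: mU].
have [n Wn] : exists n, mu [set x | C' x /\ ~ U n x] < (dl / 2)%:E.
  apply: mu_vanishing => // [n x /= [C'x nU]|].
    by split=> // -[k [kn Fk]]; apply: nU; exists k; split=> //; exact: ltnW.
  rewrite (_ : \bigcap_n _ = set0) ?measure0//; apply/seteqP; split => x //.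
  move=> H; have [[k Fk] _] := H 0%N I; have [_] := H k.+1 I.
  by apply; exists k.
pose W := [set x | C' x /\ ~ U n x].
have mWn : measurable W by exact: mW.
have UC' x : U n x -> C' x by move=> [k [_ Fk]]; exists k.
have CTU x : U n x -> ~ U n (T x).
  by move=> Ux UTx; exact: CT (UC0 n _ Ux) (UC0 n _ UTx).
have agree x : ~ W x -> ~ W (mpb_inv T x) -> swap T (U n) x = swap T C' x.
  have nW z : ~ W z -> U n z <-> C' z.
    by move=> nWz; split=> [/UC'//|C'z]; apply: contrapT => nU; exact: nWz.
  by move=> /nW e1 /nW e2; exact: (swap_ext CT).
have fixW x : W x \/ W (mpb_inv T x) -> swap T (U n) x = x.
  case=> -[C'x nU]; rewrite swap_off//.
    by move=> UTx; apply: (CT (UC0 n _ UTx)); rewrite mpb_invK; exact: C'C0.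
  by move=> Ux; apply: (CT (C'C0 _ C'x)); rewrite mpb_invK; exact: UC0 Ux.
exists (cls (swap T (U n))) => //; rewrite rho_sym; apply: Hdl => [x|].
  have [Wx|nW] := pselect (W x \/ W (mpb_inv T x)); first by right; exact: fixW.
  by left; apply: agree => ?; apply: nW; [left|right].
have mWT : measurable [set x | W (mpb_inv T x)] by exact: mset_mpbV.
apply: (@le_lt_trans _ _ (mu (W `|` [set x | W (mpb_inv T x)]))).
  apply: le_measure; rewrite ?inE; first exact: (mset_neq (Phi := Phi)).
    exact: measurableU.
  move=> x /= ne; apply: contrapT => nW; apply: ne; apply: agree => ?; apply: nW.
    by left.
  by right.
apply: le_lt_trans (measureU2 mu mWn mWT) _.
have := mu_mpbV T mWn; rewrite /= => ->.
by rewrite (splitr dl) EFinD lteD.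
Qed.

End Additivity.
End SwapNormal.

Section SwapInNormal.
Context {R : realType} {d : measure_display} {X : measurableType d}
  {mu : probability X R} {Phi : set (partial_iso mu)}.
Context {SG : separated_graphing Phi}.
Local Notation sep := (sep Phi (separated_graphing := SG)).
Local Notation cls := (\pi_(Aut mu))%qT.
Local Notation G := (L1_full_group Phi).
Local Notation D := (derived_subgroup G).
Local Notation rho := (L1_dist Phi).
Local Notation Dbar :=
  (closure_in (L1_dist Phi) (L1_full_group Phi) (derived_subgroup G)).
Local Open Scope ereal_scope.

Variable N : set (Aut mu).
Hypotheses (NG : subgroup N) (ND : N `<=` Dbar)
  (NJ : forall g x, D g -> N x -> N (x ^ g)%g)
  (Ncl : closure_in rho Dbar N = N).
Hypotheses (erg : ergodic Phi) (na : nonatomic mu).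
Variables (t : mpbij mu) (A0 : set X).
Hypotheses (Nt : N (cls t)) (At : forall x, A0 x -> ~ A0 (t x))
  (mA0 : measurable A0) (A0pos : 0 < mu A0).
Variable gam : seq (nat * nat) -> mpbij mu.
Hypotheses (gamO : forall w x, orbit_rel Phi (x, gam w x))
  (gamG : forall w, G (cls (gam w)))
  (gamX : forall x y, orbit_rel Phi (x, y) -> exists w, y = gam w x).
Variables (T : mpbij mu).
Hypotheses (GT : G (cls T)).

Let enum_cover (K : countType) (E : K -> set X) (n : nat) : set X :=
  seqDU (fun m => if unpickle m is Some k then E k else set0) n.

Let menum (K : countType) (E : K -> set X) n : (forall k, measurable (E k)) ->
  measurable (enum_cover E n).
Proof. by move=> mE; apply: seqDU_measurable => m; case: (unpickle m). Qed.

Let enum_disj (K : countType) (E : K -> set X) m n x :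
  enum_cover E m x -> enum_cover E n x -> m = n.
Proof.
move=> Em En; pose F m := if unpickle m is Some k then E k else set0.
by apply: (@trivIset_seqDU _ F m n) => //; exists x.
Qed.

Let enum_ex (K : countType) (E : K -> set X) x :
  (exists k, E k x) -> exists n, enum_cover E n x.
Proof.
move=> [k Ek].
have : (\bigcup_n enum_cover E n) x.
  by rewrite -seqDU_bigcup_eq; exists (pickle k) => //; rewrite pickleK.
by move=> [n _ En]; exists n.
Qed.

Let enum_sub (K : countType) (E : K -> set X) n x :
  enum_cover E n x -> exists2 k, unpickle n = Some k & E k x.
Proof.
by rewrite /enum_cover /seqDU => -[]; case: (unpickle n) => // k Ek _; exists k.
Qed.

(** By ergodicity almost every point has orbit maps leading into six given disjoint
    subsets of [A]. There are countably many choices of such maps, and over the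
    points with the same choice all the auxiliary pieces are available. *)
Lemma paired_swap (A E : set X) v :
  let C := [set x | E x \/ E (mpb_inv (gam v) x)] in
  measurable A -> 0 < mu A -> A `<=` A0 -> measurable E ->
  (forall x, E x -> ~ E (gam v x)) -> (forall x, C x -> ~ C (T x)) ->
  (forall x, C x -> ~ A x /\ ~ A (T x)) -> N (cls (swap T C)).
Proof.
move=> C mA Apos AA0 mE Ev CT CA.
have [F [mF FA Fpos Fdis]] := nonatomic_sequence na mA Apos.
pose J : finType := ((bool * bool) + bool)%type.
pose A_ (j : J) := F (pickle j).
pose K : countType := {ffun J -> seq (nat * nat)}.
pose V (k : K) := [set x | forall j, A_ j (gam (k j) x)].
have mV k : measurable (V k).
  by apply: mset_all => j; apply: mset_mpb; exact: mF.
have aeV : {ae mu, forall x, exists k, V k x}.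
  have H j : {ae mu, forall x, exists w, A_ j (gam w x)}.
    by apply: (ergodic_meets erg gamO gamX); [exact: mF|exact: Fpos].
  have : {ae mu, forall x, forall n,
      if unpickle n is Some j then exists w, A_ j (gam w x) else True}.
    apply/ae_foralln => n; case: (unpickle n) => [j|]; first exact: H.
    exact: aeW.
  apply: filterS => x Hx.
  have Hj (j : J) : exists w, A_ j (gam w x) by have := Hx (pickle j); rewrite pickleK.
  have [w Hw] := choice Hj; exists [ffun j => w j] => j; by rewrite ffunE.
pose En n := [set x | E x /\ enum_cover V n x].
have mEn n : measurable (En n) by apply: mset_and; [exact: mE|exact: menum].
pose Cn n := [set x | En n x \/ En n (mpb_inv (gam v) x)].
have CnC n : Cn n `<=` C by move=> x [[Ex _]|[Ex _]]; [left|right].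
apply: (swap_normal_sum NG ND Ncl GT CT (F := Cn)) => //.
- by move=> n; apply: mset_or; [exact: mEn|apply: mset_mpbV; exact: mEn].
- move=> m n x [[Ex Vx]|[Ex Vx]] [[Ex' Vx']|[Ex' Vx']].
  + exact: enum_disj Vx Vx'.
  + by case: (Ev _ Ex'); rewrite mpb_invK.
  + by case: (Ev _ Ex); rewrite mpb_invK.
  + exact: enum_disj Vx Vx'.
- by apply: mset_or; [exact: mE|apply: mset_mpbV; exact: mE].
- apply: filterS2 aeV (ae_comp (mpb_V (gam v)) aeV) => x /enum_ex[m Vm] /enum_ex[n Vn].
  split=> [[Ex|Ex]|[k /CnC]//]; first by exists m; left.
  by exists n; right.
- move=> n; pose k : K := if unpickle n is Some k then k else [ffun _ => [::]].
  apply: (@paired_swap_normal _ _ _ _ _ _ N NG ND NJ T (gam v) t (En n) A A_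
    (fun j => gam (k j))) => //.
  + by move=> x [Ex _] [Ex' _]; exact: Ev Ex Ex'.
  + by move=> x /CnC Cx /CnC; exact: CT.
  + by move=> x /AA0 Ax /AA0; exact: At.
  + by move=> x /CnC; exact: CA.
  + by move=> j x /FA.
  + by move=> i j x /Fdis Fi /Fi /(pcan_inj pickleK).
  + move=> j x [Ex /enum_sub[k' nk Vk]]; rewrite /k nk; exact: Vk.
Qed.

(** Greedy pairing: running through all words and separating sets, remove a
    piece and its image as long as both are left. The remainder meets each orbit
    at most once, hence is null: otherwise it would contain two disjoint sets of
    positive measure, and by ergodicity some orbit would meet both. *)
Lemma off_swap (A C : set X) :
  measurable A -> 0 < mu A -> A `<=` A0 -> measurable C ->
  (forall x, C x -> ~ C (T x)) -> (forall x, C x -> ~ A x /\ ~ A (T x)) ->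
  N (cls (swap T C)).
Proof.
move=> mA Apos AA0 mC CT CA.
pose vi n := odflt ([::], 0%N) (unpickle n : option (seq (nat * nat) * nat)).
pose g n := gam (vi n).1.
pose piece (Y : set X) n := [set x | (Y x /\ Y (g n x)) /\
  (sep (vi n).2 x /\ ~ sep (vi n).2 (g n x))].
pose both (Y : set X) n := [set x | piece Y n x \/ piece Y n (mpb_inv (g n) x)].
pose Rem := fix Rem n := if n is m.+1 then [set x | Rem m x /\ ~ both (Rem m) m x] else C.
have mpiece Y n : measurable Y -> measurable (piece Y n).
  move=> mY; apply: mset_and; (apply: mset_and; last first).
  - by apply: mset_mpb; exact: mY.
  - exact: mY.
  - by apply: mset_not; apply: mset_mpb; exact: msep.
  - exact: msep.
have mboth Y n : measurable Y -> measurable (both Y n).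
  by move=> mY; apply: mset_or; [exact: mpiece|apply: mset_mpbV; exact: mpiece].
have mRem n : measurable (Rem n).
  by elim: n => [|n IH] //=; apply: mset_and; [exact: IH|apply: mset_not; exact: mboth].
have bothR Y n : both Y n `<=` Y.
  by move=> x [[[Yx _] _]//|[[_]]]; rewrite mpb_invK.
have RemS m n : (m <= n)%N -> Rem n `<=` Rem m.
  by move=> /subnK <-; elim: (n - m)%N => [|k IH] x //= [/IH].
have RemC n : Rem n `<=` C by exact: (RemS 0%N n (leq0n n)).
pose F n := both (Rem n) n.
have FC n : F n `<=` C by move=> x /bothR /RemC.
have Fdis' m n x : (m < n)%N -> F m x -> ~ F n x.
  by move=> mn Fm /bothR /(RemS _ _ mn) [_]; apply.
have mF n : measurable (F n) by exact: mboth.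
have R0 : mu [set x | forall n, Rem n x] = 0.
  have mR : measurable [set x | forall n, Rem n x] by apply: mset_all.
  apply/eqP; rewrite eq_le measure_ge0 andbT leNgt; apply/negP => Rpos.
  have [Z [mZ ZR Zpos Zdis]] := nonatomic_sequence na mR Rpos.
  have meets n := ergodic_meets erg gamO gamX (mZ n) (Zpos n).
  have [x [[w0 Z0] [w1 Z1]]] : exists x,
      (exists w, Z 0%N (gam w x)) /\ (exists w, Z 1%N (gam w x)).
    apply: contrapT => H; have : {ae mu, forall x : X, ~ True}.
      by apply: filterS2 (meets 0%N) (meets 1%N) => x ? ?; case: H; exists x.
    move/(ae_null (mset_const X True)); rewrite (_ : [set _ | _] = setT); last first.
      by apply/seteqP; split.
    move=> e; have := probability_setT mu; rewrite [LHS]e => /eqP.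
    by rewrite eq_sym onee_eq0.
  move: Z0 Z1; set y := gam w0 x; set z := gam w1 x => Z0 Z1.
  have yz : y <> z by move=> e; rewrite e in Z0; have := Zdis _ _ _ Z0 Z1.
  have [v zE] := gamX (orbit_trans (orbit_sym (gamO w0 x)) (gamO w1 x)).
  have [i [yi zi]] := sepP Phi yz.
  pose n := pickle (v, i).
  have vin : vi n = (v, i) by rewrite /vi pickleK.
  have [_] := ZR _ _ Z0 n.+1; apply; left.
  have gn : g n y = z by rewrite /g vin.
  rewrite /piece /= gn vin; split=> //; split; first exact: ZR Z0 n.
  exact: ZR Z1 n.
apply: (swap_normal_sum NG ND Ncl GT CT (F := F)) => //.
- move=> m n x Fm Fn; have [mn|nm|//] := ltngtP m n; exfalso.
    exact: Fdis' mn Fm Fn.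
  exact: Fdis' nm Fn Fm.
- have mR : measurable [set x | forall n, Rem n x] by apply: mset_all.
  have := (ae_null mR).2 R0; apply: filterS => x nR; split=> [Cx|[n /FC]//].
  apply: contrapT => nF; apply: nR; elim=> [//|n IH] /=; split=> // Fx.
  by apply: nF; exists n.
- move=> n; apply: (paired_swap mA Apos AA0) => //.
  + exact: mpiece.
  + by move=> x [_ [_ nsep]] [_ [sep' _]]; exact: nsep.
  + by move=> x /FC Cx /FC; exact: CT.
  + by move=> x /FC; exact: CA.
Qed.

(** Among three disjoint subsets of [A0], a point of [C] and its image both avoid
    at least one, which leaves room for the auxiliary pieces. *)
Lemma swap_normal (C : set X) : measurable C -> (forall x, C x -> ~ C (T x)) ->
  N (cls (swap T C)).
Proof.
move=> mC CT.
have [F [mF FA0 Fpos Fdis]] := nonatomic_sequence na mA0 A0pos.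
pose E n := [set x | ~ F n x /\ ~ F n (T x)].
have mE n : measurable (E n).
  by apply: mset_and; apply: mset_not; [exact: mF|apply: mset_mpb; exact: mF].
have cE x : exists n, E n x.
  apply: contrapT => nE.
  have H n : F n x \/ F n (T x).
    by apply: contrapT => /not_orP nF; apply: nE; exists n.
  case: (H 0%N) => h0; case: (H 1%N) => h1; case: (H 2%N) => h2;
    first [by have := Fdis _ _ _ h0 h1|by have := Fdis _ _ _ h0 h2
          |by have := Fdis _ _ _ h1 h2].
pose Cn n := [set x | C x /\ enum_cover E n x].
have mCn n : measurable (Cn n) by apply: mset_and; [exact: mC|exact: (menum n mE)].
apply: (swap_normal_sum NG ND Ncl GT CT (F := Cn)) => //.
- by move=> n x [].
- by move=> m n x [_ Em] [_ En]; exact: enum_disj Em En.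
- by apply: aeW => x; split=> [Cx|[n []//]]; have [n En] := enum_ex (cE x); exists n.
- move=> n; have [[k nk]|nn] := pselect (exists k : nat, unpickle n = Some k); last first.
    have -> : Cn n = set0.
      apply/seteqP; split => x //= -[_ /enum_sub[k nk _]]; case: nn; by exists k.
    by rewrite swap0; case: NG.
  have CE x : Cn n x -> E k x by move=> [_ /enum_sub[k']]; rewrite nk => -[->].
  apply: (off_swap (mF k) (Fpos k)) => //.
  + by move=> x [Cx _] [CTx _]; exact: CT Cx CTx.
Qed.

End SwapInNormal.

(** * Recurrence *)

Section Recurrence.
Context {R : realType} {d : measure_display} {X : measurableType d}
  {mu : probability X R}.
Implicit Types (T : mpbij mu) (D : set X).
Local Open Scope ereal_scope.

Lemma mset_iter T n (P : X -> Prop) : measurable [set x | P x] ->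
  measurable [set x | P (iter n T x)].
Proof.
elim: n P => [//|n IH] P mP /=; apply: (IH (fun x => P (T x))); exact: mset_mpb.
Qed.

Lemma mset_iterV T n (P : X -> Prop) : measurable [set x | P x] ->
  measurable [set x | P (iter n (mpb_inv T) x)].
Proof. exact: (mset_iter (mpb_V T)). Qed.

Lemma ae_iterV T n (P : X -> Prop) : {ae mu, forall x, P x} ->
  {ae mu, forall x, P (iter n (mpb_inv T) x)}.
Proof.
elim: n P => [//|n IH] P aP /=.
exact: (IH (fun x => P (mpb_inv T x)) (ae_comp (mpb_V T) aP)).
Qed.

Lemma iter_iterV_le T k n x : (k <= n)%N ->
  iter k T (iter n (mpb_inv T) x) = iter (n - k) (mpb_inv T) x.
Proof.
elim: k => [|k IH] kn; first by rewrite subn0.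
by rewrite iterS IH 1?ltnW// -(subnSK kn) iterS mpb_invK.
Qed.

Lemma iter_iterV_ge T k n x : (n <= k)%N ->
  iter k T (iter n (mpb_inv T) x) = iter (k - n) T x.
Proof.
by move=> nk; rewrite -{1}(subnK nk) iterD iter_iterV_le// subnn.
Qed.

(** Poincare recurrence. The points of [D] that never come back to [D] form a null
    set: the set [W] of points without future visit contains its image [W'] of the
    same measure, and [W'] misses [D]. *)
Lemma recurrence T D : measurable D -> {ae mu, forall x,
  (exists n, D (iter n (mpb_inv T) x)) -> exists k, D (iter k.+1 T x)}.
Proof.
move=> mD; pose W := [set x | forall k, ~ D (iter k.+1 T x)].
have mW : measurable W.
  by apply: mset_all => k; apply: mset_not; exact: (mset_iter T k.+1 mD).
pose W' := [set x | W (mpb_inv T x)].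
have mW' : measurable W' by exact: mset_mpbV.
have W'E x : W' x -> ~ D x /\ W x.
  move=> H; split=> [Dx|k]; first by apply: (H 0%N); rewrite /= mpb_invK.
  by have := H k.+1; rewrite iterSr mpb_invK.
have mV : measurable [set x | D x /\ W x] by apply: mset_and; [exact: mD|exact: mW].
have V0 : mu [set x | D x /\ W x] = 0.
  apply/eqP; rewrite eq_le measure_ge0 andbT.
  have WW' : mu (W `\` W') = 0.
    rewrite measureD//; last exact: mu_lty.
    rewrite (setIidr (fun x (h : W' x) => (W'E x h).2)).
    have E : mu W' = mu W by exact: (mu_mpbV T mW).
    by rewrite [X in _ - X]E subee// ge0_fin_numE// mu_lty.
  rewrite -WW'; apply: le_measure; rewrite ?inE//; first exact: measurableD.
  by move=> x [Dx Wx]; split=> // /W'E[].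
have := (ae_null mV).2 V0 => aeV.
have : {ae mu, forall x, forall n,
    ~ (D (iter n (mpb_inv T) x) /\ W (iter n (mpb_inv T) x))}.
  by apply/ae_foralln => n; exact: (ae_iterV T n aeV).
apply: filterS => x nV [n0 Dn0].
have ex : exists n, `[< D (iter n (mpb_inv T) x) >] by exists n0; apply/asboolP.
case: (ex_minnP ex) => n /asboolP Dn nmin.
(* From the last visit to [D], the return time exceeds [n] by minimality. *)
have [k Dk] : exists k, D (iter k.+1 T (iter n (mpb_inv T) x)).
  apply: contrapT => nk; apply: (nV n); split=> // k Dk; apply: nk; by exists k.
have [kn|nk] := leqP k.+1 n.
  rewrite iter_iterV_le// in Dk; have /nmin := asboolT Dk.
  by rewrite leqNgt ltn_subrL// (leq_trans _ kn).
exists (k - n)%N; rewrite iter_iterV_ge ?(ltnW nk)// in Dk.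
by rewrite subSn in Dk.
Qed.

End Recurrence.

Section Restriction.
Context {R : realType} {d : measure_display} {X : measurableType d}
  {mu : probability X R}.
Variables (T : mpbij mu) (Z : set X).
Hypotheses (mZ : measurable Z) (TZ : forall x, Z x <-> Z (T x)).

Lemma restriction_exists : exists f : mpbij mu,
  [/\ forall x, Z x -> f x = T x /\ mpb_inv f x = mpb_inv T x &
      forall x, ~ Z x -> f x = x /\ mpb_inv f x = x].
Proof.
have TZV x : Z x <-> Z (mpb_inv T x).
  by have := TZ (mpb_inv T x); rewrite mpb_invK => -[? ?]; split.
pose f x := if `[< Z x >] then T x else x.
pose g x := if `[< Z x >] then mpb_inv T x else x.
have fE x : Z x -> f x = T x by move=> Zx; rewrite /f asboolT.
have fN x : ~ Z x -> f x = x by move=> Zx; rewrite /f asboolF.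
have gE x : Z x -> g x = mpb_inv T x by move=> Zx; rewrite /g asboolT.
have gN x : ~ Z x -> g x = x by move=> Zx; rewrite /g asboolF.
have fK : cancel f g.
  move=> x; have [Zx|nZ] := pselect (Z x); last by rewrite fN// gN.
  by rewrite fE// gE ?mpb_funK//; exact: (TZ x).1.
have gK : cancel g f.
  move=> x; have [Zx|nZ] := pselect (Z x); last by rewrite gN// fN.
  by rewrite gE// fE ?mpb_invK//; exact: (TZV x).1.
have mA (b : bool) : measurable (if b then Z else ~` Z).
  by case: b => //; exact: measurableC.
have cA x : exists b : bool, (if b then Z else ~` Z) x.
  by have [Zx|nZ] := pselect (Z x); [exists true|exists false].
have fA b x : (if b then Z else ~` Z) x -> f x = (if b then T else mpb_one mu) x.
  by case: b => H /=; [rewrite fE|rewrite fN].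
exists (glue fK gK mA cA fA); split=> x Zx; first by split; [exact: fE|exact: gE].
by split; [exact: fN|exact: gN].
Qed.

End Restriction.

(** * Commutators are generated by involutions *)

Lemma commgM_conj (gT : groupType) (x y z : gT) :
  [~ x, y * z]%g = ([~ x, z] * [~ x, y] ^ z)%g.
Proof. by rewrite !commgEl !conjgE invgM !mulgA !mulgK. Qed.

Lemma commgM_twist (gT : groupType) (x y z : gT) :
  [~ x, y * z]%g = ([~ x, y] * ([~ x, z] ^ [~ x, y] * [~ [~ x, y], z]))%g.
Proof.
rewrite commgM_conj; move: [~ x, y]%g [~ x, z]%g => a b.
by rewrite commgEl !conjgE !mulgA mulgV mul1g mulgK.
Qed.

Section Commutators.
Context {R : realType} {d : measure_display} {X : measurableType d}
  {mu : probability X R} {Phi : set (partial_iso mu)}.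
Context {SG : separated_graphing Phi}.
Local Notation sep := (sep Phi (separated_graphing := SG)).
Local Notation dist := (graph_dist Phi).
Local Notation cls := (\pi_(Aut mu))%qT.
Local Notation G := (L1_full_group Phi).
Local Notation rho := (L1_dist Phi).
Local Notation clos := (closure_in (L1_dist Phi) (L1_full_group Phi)).
Local Open Scope ereal_scope.

(** [S] is supported off [D], and [T'] is supported on [D] and the small set [tau].
    Thus they commute off [tau] and its preimage under [S]. On these two small sets
    the displacements involved are those of [S] and [T] at points translated by a
    measure-preserving map, so that absolute continuity applies although [T'] varies. *)
Lemma almost_commuting (S T : mpbij mu) (D : set X) : G (cls S) -> G (cls T) ->
  (forall x, D x -> S x = x) -> forall e : R, (0 < e)%R ->
  exists2 dl : R, (0 < dl)%R & forall (T' : mpbij mu) (tau : set X),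
    measurable tau -> mu tau < dl%:E ->
    (forall x, ~ D x -> ~ tau x -> T' x = x) -> (forall x, tau x -> T' x = T x) ->
    (forall x, tau x -> ~ D x -> tau (mpb_inv T x)) ->
    rho (cls S * cls T')%g (cls T' * cls S)%g < e%:E.
Proof.
move=> GS GT SD e e0.
have e4 : (0 < e / 4)%R by rewrite divr_gt0.
have [d1 d10 H1] := displacement_small GS e4.
have [d2 d20 H2] := displacement_small GT e4.
exists (Num.min d1 d2 / 2)%R; first by rewrite divr_gt0// lt_min d10.
move=> T' tau mtau taudl T'id T'T Ttau.
pose E := [set x | tau x \/ tau (S x)].
have mStau : measurable [set x | tau (S x)] by exact: mset_mpb.
have mE : measurable E by apply: mset_or.
have Edl : mu E < (Num.min d1 d2)%:E.
  apply: le_lt_trans (measureU2 mu mtau mStau) _.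
  have muS : mu [set x | tau (S x)] = mu tau by exact: mu_mpb.
  by rewrite [X in _ + X]muS (splitr (Num.min d1 d2)) EFinD lteD.
move: Edl; rewrite EFin_min lt_min => /andP[Ed1 Ed2].
have SND x : ~ D x -> ~ D (S x).
  by move=> nD DSx; apply: nD; rewrite -(can_inj (mpb_funK S) (SD _ DSx)).
have commute_off x : ~ E x -> mpb_mul S T' x = mpb_mul T' S x.
  move=> /not_orP[ntau ntauS] /=; have [Dx|nD] := pselect (D x); last first.
    by rewrite T'id// [RHS]T'id//; exact: SND.
  rewrite [S x]SD//; have [/SD//|nDT'] := pselect (D (T' x)).
  have [tT'|ntT'] := pselect (tau (T' x)).
    have tT := Ttau _ tT' nDT'; have := T'T _ tT; rewrite mpb_invK.
    by move/(can_inj (mpb_funK T')) => xE; rewrite xE in tT.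
  by have /(can_inj (mpb_funK T')) e' := T'id _ nDT' ntT'; rewrite e' in nDT'.
have dT' x : E x -> dist x (T' x) <= dist x (T x).
  move=> Ex; have [/T'T->//|ntau] := pselect (tau x).
  rewrite T'id ?distxx ?dist_ge0// => Dx.
  by case: Ex => //; rewrite SD.
have dT'S x : E x -> dist (S x) (T' (S x)) <= dist (S x) (T (S x)).
  move=> Ex; have [/T'T->//|ntau] := pselect (tau (S x)).
  rewrite T'id ?distxx ?dist_ge0// => DSx.
  have Sxx := can_inj (mpb_funK S) (SD _ DSx).
  by rewrite Sxx in ntau; case: Ex => //; rewrite Sxx.
have mdisp (U V : mpbij mu) : measurable_fun setT (fun x => dist (U x) (V (U x))).
  exact: (measurable_dist_mpb U (mpb_mul V U)).
pose F x := dist (T' x) (S (T' x)) + dist x (T x) + dist x (S x) + dist (S x) (T (S x)).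
have mF : measurable_fun setT F.
  apply: emeasurable_funD; last exact: mdisp.
  apply: emeasurable_funD; last exact: (mdisp (mpb_one mu)).
  by apply: emeasurable_funD; [exact: mdisp|exact: (mdisp (mpb_one mu))].
rewrite -!cls_mul; apply: (@le_lt_trans _ _ (\int[mu]_(x in E) F x)).
  apply: rho_le_on => //; first by move=> x; rewrite /F !adde_ge0 ?dist_ge0.
  move=> x Ex; rewrite /F /=.
  apply: le_trans (dist_tri _ (S x) _ _) _; apply: leeD; last exact: dT'S.
  apply: le_trans (dist_tri _ x _ _) _; apply: leeD => //.
  apply: le_trans (dist_tri _ (T' x) _ _) _; apply: leeD.
    by rewrite dist_sym.
  by rewrite dist_sym; exact: dT'.
have -> : \int[mu]_(x in E) F x = \int[mu]_(x in E) dist (T' x) (S (T' x)) +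
    \int[mu]_(x in E) dist x (T x) + \int[mu]_(x in E) dist x (S x) +
    \int[mu]_(x in E) dist (S x) (T (S x)).
  have mdE (U V : mpbij mu) : measurable_fun E (fun x => dist (U x) (V (U x))).
    exact: measurable_funS (mdisp U V).
  have m1 := mdE (mpb_one mu).
  rewrite /F !ge0_integralD//; try (by move=> x _; rewrite ?adde_ge0 ?dist_ge0).
  all: do ?[exact: mdE|exact: m1|apply: emeasurable_funD].
have -> : e = (e / 4 + e / 4 + e / 4 + e / 4)%R by lra.
rewrite !EFinD; apply: lteD; last exact: H2.
apply: lteD; last exact: (H1 (mpb_one mu)).
by apply: lteD; [exact: H1|exact: (H2 (mpb_one mu))].
Qed.

Variable H : set (Aut mu).
Hypotheses (HG : subgroup H) (HS : H `<=` G) (Hcl : clos H = H)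
  (HJ : forall g x, G g -> H x -> H (x ^ g)%g)
  (Hswap : forall (T : mpbij mu) C, G (cls T) -> measurable C ->
     (forall x, C x -> ~ C (T x)) -> H (cls (swap T C))).

Lemma H_limit x : G x ->
  (forall e : R, (0 < e)%R -> exists2 y, H y & rho x y < e%:E) -> H x.
Proof. by move=> Gx Hx; rewrite -Hcl. Qed.

Lemma commg_in x h : G x -> H h -> H [~ x, h]%g.
Proof.
move=> Gx Hh; have [_ HM HV] := HG; rewrite commgEr.
by apply: HM => //; apply: HJ => //; exact: HV.
Qed.

Section Towers.
Variables (T : mpbij mu) (D : set X).
Hypotheses (GT : G (cls T)) (mD : measurable D)
  (TD : {ae mu, forall x, T x <> x ->
     exists n, D (iter n T x) \/ D (iter n (mpb_inv T) x)}).

(** The levels of the Kakutani skyscraper of [T] over [D], where only the towers of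
    height at most [m] are kept. *)
Definition level m i := [set x | D (iter i (mpb_inv T) x) /\
  ((forall j, (j < i)%N -> ~ D (iter j (mpb_inv T) x)) /\
   exists k, (k.+1 + i <= m)%N /\ D (iter k.+1 T x))].

Definition tall m := [set x | T x <> x /\ forall i, ~ level m i x].

Lemma measurable_level m i : measurable (level m i).
Proof.
apply: mset_and; first exact: mset_iterV.
apply: mset_and.
  apply: mset_all => j; apply: mset_imp; first exact: mset_const.
  by apply: mset_not; exact: mset_iterV.
apply: mset_ex => k; apply: mset_and; first exact: mset_const.
exact: (mset_iter T k.+1 mD).
Qed.

Lemma measurable_tall m : measurable (tall m).
Proof.
apply: mset_and; first exact: (mset_neq (Phi := Phi) T (mpb_one mu)).
by apply: mset_all => i; apply: mset_not; exact: measurable_level.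
Qed.

Lemma level_inj m i j x : level m i x -> level m j x -> i = j.
Proof.
move=> [Di [ni _]] [Dj [nj _]]; have [ij|ji|//] := ltngtP i j.
  by case: (nj _ ij).
by case: (ni _ ji).
Qed.

Lemma level_next m i x : level m i.+1 x -> ~ level m i.+1 (T x).
Proof.
by move=> [_ [ni _]] [Di _]; apply: (ni i (ltnSn i)); move: Di; rewrite iterSr mpb_funK.
Qed.

Lemma level_succ m i x : level m i.+1 (T x) -> level m i x.
Proof.
move=> [Di [ni [k [km Dk]]]]; split; first by move: Di; rewrite iterSr mpb_funK.
split=> [j ji|].
  by have := ni j.+1 ji; rewrite iterSr mpb_funK.
exists k.+1; split; first by rewrite addSn -addnS.
by rewrite iterSr.
Qed.

Lemma level_lt m i x : level m i x -> (i < m)%N.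
Proof. by move=> [_ [_ [k [km _]]]]; apply: leq_trans km; rewrite addSn ltnS leq_addl. Qed.

Lemma level_pred m i x : level m i (mpb_inv T x) -> ~ D x -> level m i.+1 x.
Proof.
move=> [Di [ni [k [km Dk]]]] nD; split; first by rewrite iterSr.
split=> [[|j] ji //|]; first by rewrite iterSr; exact: ni.
case: k km Dk => [|k] km; first by rewrite /= mpb_invK.
rewrite iterSr mpb_invK => Dk; exists k; split=> //.
by rewrite addnS -addSn.
Qed.

Lemma tall_pred m x : tall m x -> ~ D x -> tall m (mpb_inv T x).
Proof.
move=> [Tx nl] nD; split.
  by rewrite mpb_invK => e; apply: Tx; rewrite {1}e mpb_invK.
by move=> i li; apply: (nl i.+1); exact: level_pred.
Qed.

(** Composing with the exchange of a level with its image turns this level into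
    fixed points and sends the points mapped into it directly to its image. With all
    the levels of the towers of height at most [m] removed, what remains on them is
    the first return map to [D]; this approximation of the full first return map
    needs finitely many exchanges only. *)
Lemma flatten_levels m j : exists T' : mpbij mu,
  [/\ H (cls T' * (cls T)^-1)%g,
      forall i x, (0 < i <= j)%N -> level m i x -> T' x = x &
      forall x, (forall i, (i <= j)%N -> ~ level m i x) -> T' x = T x].
Proof.
have [H1 HM HV] := HG.
elim: j => [|j [T' [HT' fixT' eqT']]].
  exists T; split=> [|[|i] x //|//]; first by rewrite mulgV.
have GT' : G (cls T').
  by rewrite -[cls T'](mulgVK (cls T)); apply: G_mul => //; exact: HS.
pose L := level m j.+1; have mL : measurable L by exact: measurable_level.
have T'L x : L x -> T' x = T x.
  move=> Lx; apply: eqT' => i ij li.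
  by have e := level_inj Lx li; rewrite -e ltnn in ij.
have LT' x : L x -> ~ L (T' x) by move=> Lx; rewrite T'L//; exact: level_next Lx.
exists (mpb_mul (swap T' L) T'); split=> [|i x /andP[i0 ij] li|x nl] /=.
- by rewrite cls_mul -mulgA; apply: HM => //; exact: Hswap.
- have [ij'|ij'] := leqP i j.
    have T'x : T' x = x by apply: fixT' li; rewrite i0.
    rewrite T'x swap_off//.
      by move=> Lx; have e := level_inj Lx li; rewrite -e ltnn in ij'.
    rewrite -{1}T'x mpb_funK => Lx; have e := level_inj Lx li.
    by rewrite -e ltnn in ij'.
  have e : i = j.+1 by apply/eqP; rewrite eqn_leq ij.
  by rewrite e in li; rewrite swap_img.
- have T'x : T' x = T x by apply: eqT' => i ij; apply: nl; exact: leqW.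
  rewrite swap_off//; last by rewrite mpb_funK; exact: nl.
  by rewrite T'x => /level_succ; exact: nl.
Qed.

(** By recurrence almost every point that is moved lies in a tower of finite
    height. *)
Lemma tall_small : forall e : R, (0 < e)%R -> exists m, mu (tall m) < e%:E.
Proof.
move=> e e0; apply: mu_vanishing => //; first exact: measurable_tall.
  move=> m x [Tx nl]; split=> // i [Di [ni [k [km Dk]]]].
  by apply: (nl i); split=> //; split=> //; exists k; split=> //; exact: leqW.
have mI : measurable [set x | forall m, tall m x].
  by apply: mset_all => m; exact: measurable_tall.
have -> : \bigcap_m tall m = [set x | forall m, tall m x].
  by apply/seteqP; split => x /= hx m; [exact: hx|move=> _; exact: hx].
apply/(ae_null mI); have r1 := recurrence T mD; have r2 := recurrence (mpb_V T) mD.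
apply: filterS2 TD (filterI r1 r2) => x TDx [r1x r2x] tx.
have [Tx _] := tx 0%N.
have [n Dn] : exists n, D (iter n (mpb_inv T) x).
  have [n [Dn|Dn]] := TDx Tx; last by exists n.
  by have [k Dk] := r2x (ex_intro _ n Dn); exists k.+1.
have [k Dk] := r1x (ex_intro _ n Dn).
have ex : exists n, `[< D (iter n (mpb_inv T) x) >] by exists n; apply/asboolP.
case: (ex_minnP ex) => i /asboolP Di imin.
have [_ /(_ i)] := tx (k.+1 + i)%N; apply; split=> //; split=> [j ji Dj|]; last by exists k.
by have := imin j (asboolT Dj); rewrite leqNgt ji.
Qed.

(** Modulo [H], replace [T] by [T'], which is almost supported on [D] and therefore
    almost commutes with [S]. *)
Lemma commg_displaced_id (S : mpbij mu) : G (cls S) -> (forall x, D x -> S x = x) ->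
  H [~ (cls S)^-1, (cls T)^-1]%g.
Proof.
move=> GS SD; have [H1 HM HV] := HG.
have GcomV x y : G x -> G y -> G [~ x, y]%g.
  move=> Gx Gy; rewrite commgEl conjgE; apply: G_mul; first exact: G_inv.
  by apply: G_mul; [exact: G_inv|exact: G_mul].
have GSV : G (cls S)^-1%g by exact: G_inv.
apply: H_limit => [|e e0]; first by apply: GcomV => //; exact: G_inv.
have [dl dl0 Hdl] := almost_commuting GS GT SD e0.
have [m tm] := tall_small dl0.
have [T' [HT' fixT' eqT']] := flatten_levels m m.
set h := (cls T' * (cls T)^-1)%g in HT'.
have GT' : G (cls T').
  by rewrite -[cls T'](mulgVK (cls T)); apply: G_mul => //; exact: HS.
have small : rho (cls S * cls T')%g (cls T' * cls S)%g < e%:E.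
  apply: (Hdl T' (tall m)) => //; first exact: measurable_tall.
  - move=> x nD nt; have [[i li]|nl] := pselect (exists i, level m i x).
      apply: fixT' (li); rewrite (ltnW (level_lt li)) andbT lt0n.
      by apply/eqP => i0; rewrite i0 in li; case: li.
    have nl' i : ~ level m i x by move=> li; apply: nl; exists i.
    by rewrite eqT'//; apply: contrapT => Tx; apply: nt.
  - by move=> x [_ nl]; apply: eqT'.
  - exact: tall_pred.
pose eps := [~ (cls S)^-1, (cls T')^-1]%g.
have Geps : G eps by apply: GcomV => //; exact: G_inv.
have epsE : rho eps 1%g < e%:E.
  rewrite -(rho_mulr (cls T' * cls S)%g) mul1g.
  have -> : (eps * (cls T' * cls S) = cls S * cls T')%g; last exact: small.
  by rewrite /eps commgEl conjgE !invgK !mulgA mulgVK mulgVK.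
have TE : ((cls T)^-1 = (cls T')^-1 * h)%g by rewrite /h mulKg.
exists ([~ (cls S)^-1, h] ^ eps * [~ eps, h])%g.
  by apply: HM; [apply: HJ => //; exact: commg_in|exact: commg_in].
have -> : ([~ (cls S)^-1, (cls T)^-1] = eps * ([~ (cls S)^-1, h] ^ eps * [~ eps, h]))%g.
  by rewrite TE commgM_twist.
by rewrite -[X in rho _ X]mul1g rho_mulr.
Qed.

End Towers.
End Commutators.

Section AllCommutators.
Context {R : realType} {d : measure_display} {X : measurableType d}
  {mu : probability X R} {Phi : set (partial_iso mu)}.
Context {SG : separated_graphing Phi}.
Local Notation sep := (sep Phi (separated_graphing := SG)).
Local Notation cls := (\pi_(Aut mu))%qT.
Local Notation G := (L1_full_group Phi).
Local Notation rho := (L1_dist Phi).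
Local Notation clos := (closure_in (L1_dist Phi) (L1_full_group Phi)).
Local Open Scope ereal_scope.

Variable H : set (Aut mu).
Hypotheses (HG : subgroup H) (HS : H `<=` G) (Hcl : clos H = H)
  (HJ : forall g x, G g -> H x -> H (x ^ g)%g)
  (Hswap : forall (T : mpbij mu) C, G (cls T) -> measurable C ->
     (forall x, C x -> ~ C (T x)) -> H (cls (swap T C))).

(** If [S] moves [D] off itself, composing [S] with the exchange of [D] with its
    image gives an element that is the identity on [D]. *)
Lemma commg_displaced (S T : mpbij mu) (D : set X) :
  G (cls S) -> G (cls T) -> measurable D ->
  (forall x, D x -> S x = x) \/ (forall x, D x -> ~ D (S x)) ->
  {ae mu, forall x, T x <> x -> exists n, D (iter n T x) \/ D (iter n (mpb_inv T) x)} ->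
  H [~ (cls S)^-1, (cls T)^-1]%g.
Proof.
move=> GS GT mD [SD|SD] TD.
  exact: (commg_displaced_id HG HS Hcl HJ Hswap GT mD TD GS SD).
have [H1 HM HV] := HG.
pose w := cls (swap S D); have Hw : H w by exact: Hswap.
have GS' : G (cls (mpb_mul (swap S D) S)) by rewrite cls_mul; apply: G_mul => //; exact: HS.
have : H [~ (cls (mpb_mul (swap S D) S))^-1, (cls T)^-1]%g.
  apply: (commg_displaced_id HG HS Hcl HJ Hswap GT mD TD GS') => x Dx.
  exact: swap_img.
rewrite cls_mul -/w invgM; set y := (cls T)^-1%g => Hy.
have -> : ((cls S)^-1 = (cls S)^-1 * w^-1 * w)%g by rewrite mulgVK.
have commE (a b c : Aut mu) : [~ a * b, c]%g = ([~ a, c] ^ b * [~ b, c])%g.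
  by rewrite !commgEl !conjgE invgM !mulgA !mulgK.
rewrite commE; apply: HM; first by apply: HJ => //; exact: HS.
rewrite -invgR; apply: HV; apply: (commg_in HG HJ) => //.
exact: G_inv.
Qed.

Lemma iter_restrict (T f : X -> X) (Z : set X) : (forall x, Z x -> f x = T x) ->
  (forall x, Z x -> Z (T x)) -> forall n x, Z x -> iter n f x = iter n T x.
Proof.
move=> fT ZT n x Zx; have [] // : Z (iter n T x) /\ iter n f x = iter n T x.
elim: n => [//|n [Zn IH]] /=; split; first exact: ZT.
by rewrite IH fT.
Qed.

(** The space is covered by the fixed points of [S] and by the countably many sets
    that a separating set shows to be displaced. Cut [T] along the [T]-invariant
    sets generated by them: each part of [T] meets the corresponding set on all its
    nontrivial orbits, and [T] is the limit of the products of its parts. *)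
Lemma commg_in_swaps (S T : mpbij mu) : G (cls S) -> G (cls T) ->
  H [~ (cls S)^-1, (cls T)^-1]%g.
Proof.
move=> GS GT; have [H1 HM HV] := HG.
pose D k := if k is i.+1 then [set x | sep i x /\ ~ sep i (S x)] else [set x | S x = x].
have mD k : measurable (D k).
  case: k => [|i] /=.
    have -> : [set x | S x = x] = [set x | ~ (S x <> x)].
      by apply/seteqP; split => x /=; [move=> ? ?|move/contrapT].
    by apply: mset_not; exact: (mset_neq (Phi := Phi) S (mpb_one mu)).
  by apply: mset_and; [exact: msep|apply: mset_not; apply: mset_mpb; exact: msep].
have SD k : (forall x, D k x -> S x = x) \/ (forall x, D k x -> ~ D k (S x)).
  by case: k => [|i]; [left|right=> x [_ ns] []].
have cD x : exists k, D k x.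
  have [Sx|/nesym/(sepP Phi)[i Di]] := pselect (S x = x); first by exists 0%N.
  by exists i.+1.
pose Z k := [set x | exists n, D k (iter n T x) \/ D k (iter n (mpb_inv T) x)].
have mZ k : measurable (Z k).
  by apply: mset_ex => n; apply: mset_or; [apply: mset_iter|apply: mset_iterV]; exact: mD.
have ZT k x : Z k x <-> Z k (T x).
  split=> -[n [Dn|Dn]].
  - case: n Dn => [|n] Dn; first by exists 1%N; right; rewrite /= mpb_funK.
    by exists n; left; rewrite -iterSr.
  - by exists n.+1; right; rewrite iterSr mpb_funK.
  - by exists n.+1; left; rewrite iterSr.
  - case: n Dn => [|n] Dn; first by exists 1%N; left.
    by exists n; right; move: Dn; rewrite iterSr mpb_funK.
pose V k := [set x | Z k x /\ forall j, (j < k)%N -> ~ Z j x].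
pose U n := [set x | exists j, (j < n)%N /\ Z j x].
have mV k : measurable (V k).
  apply: mset_and; first exact: mZ.
  by apply: mset_all => j; apply: mset_imp; [exact: mset_const|apply: mset_not; exact: mZ].
have mU n : measurable (U n).
  by apply: mset_ex => j; apply: mset_and; [exact: mset_const|exact: mZ].
have VT k x : V k x <-> V k (T x).
  split=> -[Zx nZ]; split.
  - exact: (ZT k x).1.
  - by move=> j jk Zj; apply: (nZ j jk); exact: (ZT j x).2.
  - exact: (ZT k x).2.
  - by move=> j jk Zj; apply: (nZ j jk); exact: (ZT j x).1.
have UT n x : U n x <-> U n (T x).
  by split=> -[j [jn Zj]]; exists j; split=> //; [exact: (ZT j x).1|exact: (ZT j x).2].
have [Vres Vresp] := choice (fun k => restriction_exists (mV k) (VT k)).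
have [Ures Uresp] := choice (fun n => restriction_exists (mU n) (UT n)).
have Gres (f : mpbij mu) : (forall x, f x = T x \/ f x = x) -> G (cls f).
  move=> fT.
  apply: (@G_finite_choice _ _ _ _ _ _ bool (fun b => if b then T else mpb_one mu)).
    by case=> //; exact: G_one.
  by move=> x; case: (fT x) => ->; [exists true|exists false].
have UresT n x : Ures n x = T x \/ Ures n x = x.
  have [uT uF] := Uresp n.
  by have [/uT[]|/uF[]] := pselect (U n x); [left|right].
have HVres k : H [~ (cls S)^-1, (cls (Vres k))^-1]%g.
  have [vT vF] := Vresp k.
  apply: (commg_displaced GS _ (mD k) (SD k)).
    by apply: Gres => x; have [/vT[]|/vF[]] := pselect (V k x); [left|right].
  apply: aeW => x vx.
  have Vx : V k x by apply: contrapT => /vF[].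
  have [[n Dn] _] := Vx; exists n.
  rewrite (@iter_restrict T (Vres k) (V k))//; last 2 first.
  - by move=> z /vT[].
  - by move=> z; exact: (VT k z).1.
  rewrite (@iter_restrict (mpb_inv T) (mpb_inv (Vres k)) (V k))//; first by move=> z /vT[].
  by move=> z Vz; apply: (VT k _).2; rewrite mpb_invK.
have HUres n : H [~ (cls S)^-1, (cls (Ures n))^-1]%g.
  elim: n => [|n IH].
    have -> : cls (Ures 0%N) = 1%g.
      rewrite -cls_one; apply: cls_eq => x; have [_ uF] := Uresp 0%N.
      by have [] // := uF x; case=> j [].
    by rewrite invg1 commg1.
  have -> : cls (Ures n.+1) = (cls (Ures n) * cls (Vres n))%g.
    rewrite -cls_mul; apply: cls_eq => x /=.
    have [uT uF] := Uresp n; have [vT vF] := Vresp n; have [uT' uF'] := Uresp n.+1.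
    have [Vx|nV] := pselect (V n x).
      rewrite (vT _ Vx).1 (uF (T x) _).1.
        by apply: (uT' x _).1; exists n; split=> //; case: Vx.
      by move=> [j [jn Zj]]; have [_ nZ] := (VT n x).1 Vx; exact: nZ jn Zj.
    rewrite (vF _ nV).1; have [Ux|nU] := pselect (U n x).
      rewrite (uT _ Ux).1; apply: (uT' x _).1.
      by case: Ux => j [jn Zj]; exists j; split=> //; exact: ltnW.
    rewrite (uF _ nU).1; apply: (uF' x _).1 => -[j [jn Zj]].
    move: jn; rewrite ltnS leq_eqVlt => /orP[/eqP jn|jn]; last by apply: nU; exists j.
    apply: nV; rewrite jn in Zj; split=> // i ij Zi; by apply: nU; exists i.
  rewrite invgM commgM_conj; apply: HM => //; apply: HJ => //.
  by apply: G_inv; exact: Gres.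
have GSV : G (cls S)^-1%g by exact: G_inv.
have GTV : G (cls T)^-1%g by exact: G_inv.
apply: (H_limit Hcl) => [|e e0].
  rewrite commgEl conjgE; apply: G_mul; first exact: G_inv.
  by apply: G_mul; [exact: G_inv|exact: G_mul].
have [d1 d10 H1'] := commg_small GSV GTV e0.
have [d2 d20 H2] := rho_mull GTV d10.
have [d3 d30 H3] := rho_restrict_small GT d20.
have mnU n : measurable [set x | ~ U n x] by apply: mset_not; exact: mU.
have [n nU] : exists n, mu [set x | ~ U n x] < d3%:E.
  apply: mu_vanishing => // [n x nU [j [jn Zj]]|].
    by apply: nU; exists j; split=> //; exact: ltnW.
  rewrite (_ : \bigcap_n _ = set0) ?measure0//; apply/seteqP; split => x // nU.
  have [k Dk] := cD x; apply: (nU k.+1 I); exists k; split=> //.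
  by exists 0%N; left.
exists [~ (cls S)^-1, (cls (Ures n))^-1]%g => //.
rewrite rho_sym; apply: H1'; first by apply: G_inv; apply: Gres; exact: UresT.
have -> : rho (cls (Ures n))^-1%g (cls T)^-1%g =
    rho ((cls T)^-1 * cls (Ures n))%g ((cls T)^-1 * cls T)%g.
  by rewrite -(rho_mulr (cls (Ures n))) mulVg mulVg rho_sym.
apply: H2; apply: H3 => //; apply: le_lt_trans nU.
apply: le_measure; rewrite ?inE//; first exact: (mset_neq (Phi := Phi)).
move=> x /= ne Ux; apply: ne; exact: ((Uresp n).1 x Ux).1.
Qed.

End AllCommutators.

(** * Ergodicity implies topological simplicity *)

Section ErgodicSimple.
Context {R : realType} {d : measure_display} {X : measurableType d}
  {mu : probability X R} {Phi : set (partial_iso mu)}.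
Context {SG : separated_graphing Phi}.
Local Notation sep := (sep Phi (separated_graphing := SG)).
Local Notation cls := (\pi_(Aut mu))%qT.
Local Notation G := (L1_full_group Phi).
Local Notation D := (derived_subgroup G).
Local Notation rho := (L1_dist Phi).
Local Notation clos := (closure_in (L1_dist Phi) (L1_full_group Phi)).
Local Notation Dbar := (clos D).
Local Open Scope ereal_scope.

Lemma displaced_set (t : mpbij mu) : cls t <> 1%g -> exists A : set X,
  [/\ measurable A, 0 < mu A & forall x, A x -> ~ A (t x)].
Proof.
move=> t1; pose A := [set x | t x <> x].
have mA : measurable A by exact: (mset_neq (Phi := Phi) t (mpb_one mu)).
have Apos : 0 < mu A.
  rewrite lt_neqAle measure_ge0 andbT; apply/eqP => /esym/(ae_null mA) aeA; apply: t1.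
  by rewrite -cls_one; apply/aut_eqP; apply: filterS aeA => x /contrapT.
pose E i := [set x | sep i x /\ ~ sep i (t x)].
have mE i : measurable (E i).
  by apply: mset_and; [exact: msep|apply: mset_not; apply: mset_mpb; exact: msep].
have [|i Ei] := positive_piece mA mE Apos.
  by apply: aeW => x /nesym/(sepP Phi)[i Ei]; exists i.
exists (A `&` E i); split=> //; first exact: measurableI.
by move=> x [_ [_ nsep]] [_ [sep' _]].
Qed.

(** [N] contains all exchanges. As it is only normalized by the closed derived
    subgroup, the quotient argument takes place in [J], the largest subgroup of the
    closure of [N] that is normal in the whole full group; it still contains the
    exchanges because their conjugates are exchanges. *)
Lemma ergodic_simple : nonatomic mu -> ergodic Phi -> topologically_simple rho Dbar.
Proof.
move=> na erg N ND /group_closedE NG NJ Ncl.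
have [N1 NM NV] := NG.
have DDbar : D `<=` Dbar by apply: sub_clos; apply: derived_sub; exact: G_subgroup.
have NJ' g x : D g -> N x -> N (x ^ g)%g by move=> /DDbar; exact: NJ.
have NG' : N `<=` G by move=> x /ND[].
have [triv|nontriv] := pselect (forall x, N x -> x = 1%g).
  by left; apply/seteqP; split => [x /triv|x ->].
right; have [t Nt t1] : exists2 t, N (cls t) & cls t <> 1%g.
  apply: contrapT => nt; apply: nontriv => x Nx; apply: contrapT => x1.
  by apply: nt; exists (repr x); rewrite reprK.
have [A0 [mA0 A0pos At]] := displaced_set t1.
have [gam [gamO gamG gamX]] := orbit_maps (Phi := Phi).
have Nswap (T : mpbij mu) C : G (cls T) -> measurable C ->
    (forall x, C x -> ~ C (T x)) -> N (cls (swap T C)).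
  by move=> GT; exact: (swap_normal NG ND NJ' Ncl erg na Nt At mA0 A0pos gamO gamG gamX GT).
have GJ x g : G x -> G g -> G (x ^ g)%g.
  move=> Gx Gg; rewrite conjgE; apply: G_mul; first exact: G_inv.
  exact: G_mul.
pose M := clos N; have [M1 MM MV] : subgroup M by exact: clos_subgroup.
pose J : set (Aut mu) := [set x | G x /\ forall g, G g -> M (x ^ g)%g].
have JG : subgroup J.
  split=> [|x y [Gx Hx] [Gy Hy]|x [Gx Hx]].
  - by split=> [|g Gg]; [exact: G_one|rewrite conjgE mul1g mulVg].
  - split=> [|g Gg]; first exact: G_mul.
    have -> : ((x * y) ^ g = x ^ g * y ^ g)%g by rewrite !conjgE !mulgA mulgK.
    by apply: MM; [exact: Hx|exact: Hy].
  - split=> [|g Gg]; first exact: G_inv.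
    have -> : (x^-1 ^ g = (x ^ g)^-1)%g by rewrite !conjgE !invgM invgK !mulgA.
    by apply: MV; exact: Hx.
have JS : J `<=` G by move=> x [].
have JJ g x : G g -> J x -> J (x ^ g)%g.
  move=> Gg [Gx Hx]; split=> [|h Gh]; first exact: GJ.
  by rewrite -conjgM; apply: Hx; exact: G_mul.
have Jcl : clos J = J.
  apply/seteqP; split=> [x Jx|]; last exact: sub_clos.
  split=> [|g Gg]; first by case: Jx.
  rewrite /M -clos_clos; apply: (clos_conjg Gg) Jx => y [_]; exact.
have Jswap (T : mpbij mu) C : G (cls T) -> measurable C ->
    (forall x, C x -> ~ C (T x)) -> J (cls (swap T C)).
  move=> GT mC CT; split=> [|g Gg]; first exact: G_swap.
  apply: sub_clos => //; rewrite -[g]reprK swap_conjg//; apply: Nswap.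
  - by rewrite !cls_mul cls_inv reprK; apply: G_mul; [exact: G_inv|exact: G_mul].
  - exact: mset_mpb.
  - by move=> x Cx /=; rewrite mpb_invK; exact: CT.
have NMD x : M x -> Dbar x -> N x.
  by move=> [_ Mx] Dx; rewrite -Ncl; split.
have DN : D `<=` N.
  apply: derived_subset => // x y Gx Gy.
  have Jxy : J [~ x, y]%g.
    rewrite -[x]invgK -[y]invgK -[x^-1%g]reprK -[y^-1%g]reprK.
    apply: (commg_in_swaps JG JS Jcl JJ Jswap); rewrite reprK; exact: G_inv.
  apply: NMD; last by apply: DDbar; exact: derived_commg.
  by have [_ /(_ _ G_one)] := Jxy; rewrite conjg1.
apply/seteqP; split=> // x Dx; rewrite -Ncl; split=> // e /(Dx.2)[y /DN Ny xy].
by exists y.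
Qed.

End ErgodicSimple.

Theorem corollary3p25 (R : realType) (d : measure_display)
    (X : measurableType d) (mu : probability X R)
    (Phi : set (partial_iso mu)) :
  standard_borel R X -> nonatomic mu ->
  graphing Phi -> aperiodic Phi ->
  (ergodic Phi <->
   topologically_simple (L1_dist Phi)
    (closure_in (L1_dist Phi) (L1_full_group Phi)
       (derived_subgroup (L1_full_group Phi)))).
Proof.
move=> /separating_family[B [mB BP]] na cPhi ap.
have SG : separated_graphing Phi by exact: (SeparatedGraphing mB BP cPhi).
by split=> [|simple]; [exact: ergodic_simple|exact: simple_ergodic].
Qed.
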